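(* There exist groups that are of type $FP_2(F)$ for all fields $F$, but not of type $FP_2(\mathbb{Z})$.
   Context: A group $G$ is of type $FP_n(R)$, for a ring $R$, if there is an exact sequence $P_n\to\dots\to P_1\to P_0\to R\to 0$ of projective $RG$-modules such that each $P_i$ is finitely generated, where $R$ is the trivial $RG$-module. *)

(* Defs.v *)
From HB Require Import structures.
From mathcomp Require Import all_boot all_order all_algebra.
From mathcomp Require Import finmap.
From mathcomp.multinomials Require Import monalg.

Set Implicit Arguments.
Unset Strict Implicit.
Unset Printing Implicit Defensive.

Import GRing.Theory.

Local Open Scope fset_scope.
Local Open Scope ring_scope.

(* The group ring R[G]: the finitely supported functions {malg R[G]} with the
   convolution product.  monalg only puts a product on {malg R[K]} when K is a
   monomType, whose axiom unitm (x * y = 1 -> x = 1 /\ y = 1) excludes every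
   nontrivial group; hence the alias. *)
Definition group_ring (R : pzRingType) (G : groupType) : Type := {malg R[G]}.

HB.instance Definition _ (R : pzRingType) (G : groupType) :=
  GRing.Zmodule.copy (group_ring R G) {malg R[G]}.

Section GroupRing.
Variables (R : pzRingType) (G : groupType).
Implicit Types (a b c : group_ring R G) (g h : G) (x y : R).

Definition gr_one : group_ring R G := mkmalgU (1%g : G) (1 : R).

Definition gr_mul a b : group_ring R G :=
  \sum_(g <- msupp a) \sum_(h <- msupp b)
     mkmalgU (g * h)%g (mcoeff g a * mcoeff h b).

Lemma gr_mulw (d1 d2 : {fset G}) a b :
  msupp a `<=` d1 -> msupp b `<=` d2 ->
  gr_mul a b = \sum_(g <- d1) \sum_(h <- d2)
     mkmalgU (g * h)%g (mcoeff g a * mcoeff h b).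
Proof.
move=> le1 le2; rewrite /gr_mul (big_fset_incl _ le1) /=.
  apply/eq_bigr=> g _; apply/big_fset_incl => // h _ /mcoeff_outdom ->.
  by rewrite mulr0 monalgU0.
move=> g _ /mcoeff_outdom ag.
by rewrite big1 => // h _; rewrite ag mul0r monalgU0.
Qed.

Lemma gr_mulDl : left_distributive gr_mul +%R.
Proof.
move=> a b c; have cc := fsubset_refl (msupp c).
rewrite [LHS](gr_mulw (msuppD_le a b) cc).
rewrite (gr_mulw (fsubsetUl (msupp a) (msupp b)) cc).
rewrite (gr_mulw (fsubsetUr (msupp a) (msupp b)) cc).
rewrite -big_split /=; apply/eq_bigr=> g _.
rewrite -big_split /=; apply/eq_bigr=> h _.
by rewrite mcoeffD mulrDl monalgUD.
Qed.

Lemma gr_mulDr : right_distributive gr_mul +%R.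
Proof.
move=> c a b; have cc := fsubset_refl (msupp c).
rewrite [LHS](gr_mulw cc (msuppD_le a b)).
rewrite (gr_mulw cc (fsubsetUl (msupp a) (msupp b))).
rewrite (gr_mulw cc (fsubsetUr (msupp a) (msupp b))).
rewrite -big_split /=; apply/eq_bigr=> g _.
rewrite -big_split /=; apply/eq_bigr=> h _.
by rewrite mcoeffD mulrDr monalgUD.
Qed.

Lemma gr_mul0r : left_zero 0 gr_mul.
Proof. by move=> a; rewrite /gr_mul msupp0 big_seq_fset0. Qed.

Lemma gr_mulr0 : right_zero 0 gr_mul.
Proof.
by move=> a; rewrite /gr_mul msupp0 big1 // => g _; rewrite big_seq_fset0.
Qed.

Lemma gr_mulUU x y g h :
  gr_mul (mkmalgU g x) (mkmalgU h y) = mkmalgU (g * h)%g (x * y).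
Proof. by rewrite (gr_mulw msuppU_le msuppU_le) !big_seq_fset1 !mcoeffUU. Qed.

Lemma gr_mul_suml I (r : seq I) (F : I -> group_ring R G) b :
  gr_mul (\sum_(i <- r) F i) b = \sum_(i <- r) gr_mul (F i) b.
Proof. exact: (big_morph (gr_mul^~ b) (fun _ _ => gr_mulDl _ _ _) (gr_mul0r b)). Qed.

Lemma gr_mul_sumr I (r : seq I) (F : I -> group_ring R G) b :
  gr_mul b (\sum_(i <- r) F i) = \sum_(i <- r) gr_mul b (F i).
Proof. exact: (big_morph (gr_mul b) (fun _ _ => gr_mulDr _ _ _) (gr_mulr0 b)). Qed.

Lemma gr_ind (P : group_ring R G -> Prop) :
  P 0 -> (forall a b, P a -> P b -> P (a + b)) ->
  (forall g x, P (mkmalgU g x)) -> forall a, P a.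
Proof. by move=> P0 PD PU a; rewrite [a]monalgE; apply: big_ind. Qed.

Lemma gr_mulA : associative gr_mul.
Proof.
elim/gr_ind => [|a a' IHa IHa'|g x] b c; first by rewrite !gr_mul0r.
  by rewrite !gr_mulDl IHa IHa'.
elim/gr_ind: b => [|b b' IHb IHb'|h y]; first by rewrite gr_mulr0 !gr_mul0r gr_mulr0.
  by rewrite gr_mulDl !gr_mulDr gr_mulDl IHb IHb'.
elim/gr_ind: c => [|c c' IHc IHc'|k z]; first by rewrite !gr_mulr0.
  by rewrite !gr_mulDr IHc IHc'.
by rewrite !gr_mulUU mulrA mulgA.
Qed.

Lemma gr_mul1r : left_id gr_one gr_mul.
Proof.
elim/gr_ind => [|a a' IHa IHa'|g x]; first by rewrite gr_mulr0.
  by rewrite gr_mulDr IHa IHa'.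
by rewrite gr_mulUU mul1g mul1r.
Qed.

Lemma gr_mulr1 : right_id gr_one gr_mul.
Proof.
elim/gr_ind => [|a a' IHa IHa'|g x]; first by rewrite gr_mul0r.
  by rewrite gr_mulDl IHa IHa'.
by rewrite gr_mulUU mulg1 mulr1.
Qed.

End GroupRing.

HB.instance Definition _ (R : pzRingType) (G : groupType) :=
  GRing.Zmodule_isPzRing.Build (group_ring R G)
    (@gr_mulA R G) (@gr_mul1r R G) (@gr_mulr1 R G)
    (@gr_mulDl R G) (@gr_mulDr R G).

Section Augmentation.
Variables (R : pzRingType) (G : groupType).
Implicit Types (a b : group_ring R G).

Definition augmentation a : R := \sum_(g <- msupp a) mcoeff g a.

Lemma augmentationw (d : {fset G}) a :
  msupp a `<=` d -> augmentation a = \sum_(g <- d) mcoeff g a.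
Proof. by move=> le; apply/big_fset_incl => // g _ /mcoeff_outdom. Qed.

Lemma augmentation0 : augmentation 0 = 0.
Proof. by rewrite /augmentation msupp0 big_seq_fset0. Qed.

Lemma augmentationD : {morph augmentation : a b / a + b}.
Proof.
move=> a b; rewrite (augmentationw (msuppD_le a b)).
rewrite (augmentationw (fsubsetUl (msupp a) (msupp b))).
rewrite (augmentationw (fsubsetUr (msupp a) (msupp b))).
by rewrite -big_split /=; apply/eq_bigr=> g _; rewrite mcoeffD.
Qed.

Lemma augmentationU (g : G) (x : R) : augmentation (mkmalgU g x) = x.
Proof. by rewrite (augmentationw msuppU_le) big_seq_fset1 mcoeffUU. Qed.

Lemma augmentation1 : augmentation 1 = 1.
Proof. exact: augmentationU. Qed.

Lemma augmentationM : {morph augmentation : a b / a * b}.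
Proof.
elim/gr_ind => [|a a' IHa IHa'|g x] b.
- by rewrite mul0r augmentation0 mul0r.
- by rewrite mulrDl !augmentationD IHa IHa' mulrDl.
elim/gr_ind: b => [|b b' IHb IHb'|h y].
- by rewrite mulr0 augmentation0 mulr0.
- by rewrite mulrDr !augmentationD IHb IHb' mulrDr.
by rewrite [X in augmentation X](gr_mulUU x y g h) !augmentationU.
Qed.

End Augmentation.

(* R with every g in G acting as the identity, i.e. R[G] acting through the
   augmentation. *)
Definition trivial_module (R : pzRingType) (G : groupType) : Type := R.

HB.instance Definition _ (R : pzRingType) (G : groupType) :=
  GRing.Zmodule.copy (trivial_module R G) R.

Section TrivialModule.
Variables (R : pzRingType) (G : groupType).

Definition triv_scale (a : group_ring R G) (x : trivial_module R G) :
  trivial_module R G := augmentation a * (x : R).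

Lemma triv_scaleA a b x :
  triv_scale a (triv_scale b x) = triv_scale (a * b) x.
Proof. by rewrite /triv_scale augmentationM mulrA. Qed.

Lemma triv_scale1 : left_id 1 triv_scale.
Proof. by move=> x; rewrite /triv_scale augmentation1 mul1r. Qed.

Lemma triv_scaleDr : right_distributive triv_scale +%R.
Proof. by move=> a x y; rewrite /triv_scale -mulrDr. Qed.

Lemma triv_scaleDl x : {morph triv_scale^~ x : a b / a + b}.
Proof. by move=> a b; rewrite /triv_scale augmentationD mulrDl. Qed.

End TrivialModule.

HB.instance Definition _ (R : pzRingType) (G : groupType) :=
  GRing.Zmodule_isLmodule.Build (group_ring R G) (trivial_module R G)
    (@triv_scaleA R G) (@triv_scale1 R G) (@triv_scaleDr R G)
    (@triv_scaleDl R G).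

Section Modules.
Variable A : pzRingType.

Definition surjective_fun (T U : Type) (f : T -> U) : Prop :=
  forall y, exists x, f x = y.

Definition finitely_generated (M : lmodType A) : Prop :=
  exists (n : nat) (v : 'I_n -> M),
    forall x : M, exists a : 'I_n -> A, x = \sum_(i < n) a i *: v i.

Definition projective (P : lmodType A) : Prop :=
  forall (M N : lmodType A) (p : {linear M -> N}) (f : {linear P -> N}),
    surjective_fun p -> exists h : {linear P -> M}, forall x, p (h x) = f x.

Definition exact_at (L M N : lmodType A) (f : L -> M) (g : M -> N) : Prop :=
  forall x : M, g x = 0 <-> exists y : L, f y = x.

End Modules.

(* Only P 0, ..., P n and d 0, ..., d n.-1 are constrained; the indexing by all
   of nat merely avoids dependent bounds, and nothing is asked of the kernel of
   P n -> P n.-1. *)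
Definition type_FP (n : nat) (R : pzRingType) (G : groupType) : Prop :=
  exists (P : nat -> lmodType (group_ring R G))
         (d : forall i, {linear P i.+1 -> P i})
         (eps : {linear P 0%N -> trivial_module R G}),
    [/\ forall i, (i <= n)%N -> projective (P i) /\ finitely_generated (P i),
        surjective_fun eps,
        (0 < n)%N -> exact_at (d 0%N) eps
      & forall i, (i.+1 < n)%N -> exact_at (d i.+1) (d i)].

(* Main.v *)
Require Import Defs.
From HB Require Import structures.
From mathcomp Require Import all_boot all_order all_algebra.
From mathcomp Require Import finmap generic_quotient ring_quotient boolp ring.
From mathcomp.multinomials Require Import monalg.

(** The group is Abels' group modulo its centre.  Abels' group consists of the
    upper triangular 4 x 4 matrices over Z[1/2] whose diagonal is
    (1, 2^i, 2^j, 1) with i and j integers; its centre, the group of matrices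
    I + a E14, is isomorphic to Z[1/2], and Abels' group is finitely presented.
    Write G for the quotient and K = Z[1/2] for the centre.  A presentation of
    G is obtained from a finite presentation of Abels' group by killing K, so
    that, over a ring R, everything depends on the trivial module K (x) R.
    It is cyclic over every field R, being zero in characteristic 2 and a line
    generated by 1 (x) 1 otherwise; but over R = Z it is not finitely
    generated.

    Over a field F: let M be the quotient of the free module with one basis
    vector for each of five generators of G by the finitely many Fox
    derivatives of the relators.  The relators then hold in the semidirect
    product of M and G for the pairs (basis vector, generator).  Any five
    elements satisfying the relators span homomorphic images of the root
    subgroups of G, because each root subgroup Z[1/2] is a union of conjugates
    of Z under the diagonal (dpow), and commutators of root elements are
    determined by those at 1, as two linearly independent weights can be
    adjusted separately (commg_dpow).  The one relation of G that does not
    follow is that the corner commutators vanish; they form an additive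
    function of Z[1/2], with values in the F-vector space M, that is 0 at 1,
    hence is 0 (central_wordD, dyadic_additive_eq0).  So G lifts to the
    semidirect product (abels_wordM).  Such a lift is a derivation G -> M,
    which is what exactness of the partial resolution at the free module on the
    generators amounts to (type_FP2_criterion).

    Over Z: let c be the 2-cocycle of the central extension of G by K.  From a
    resolution P2 -> P1 -> P0 -> Z with all three modules finitely generated and
    projective, comparing it with the bar resolution shows that c is a
    coboundary modulo a finitely generated subgroup of K
    (FP2_cocycle_finite).  For commuting g and h the difference c(g,h) - c(h,g)
    is unchanged by coboundaries.  As I + E12 and I + a E24 commute in G and
    have commutator I + a E14 in Abels' group, that subgroup would contain every
    a in Z[1/2] (abels_not_FP2_int), whereas the elements of a finitely
    generated subgroup of the rationals have a common denominator. *)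

Set Implicit Arguments.
Unset Strict Implicit.
Unset Printing Implicit Defensive.

Import Order.TTheory GRing.Theory Num.Theory.

Local Open Scope fset_scope.
Local Open Scope ring_scope.

(** * Dyadic rationals *)

Definition dyadic : {pred rat} :=
  fun q => `[< exists (k : int) (n : nat), q = k%:~R / 2 ^+ n >].

Lemma dyadic_subring : subring_closed dyadic.
Proof.
have two0 n : (2 : rat) ^+ n != 0 by rewrite expf_eq0 andbF.
split=> [|a b|a b].
- by apply/asboolP; exists 1, 0; rewrite expr0 divr1.
- move=> /asboolP[k [n ->]] /asboolP[l [m ->]]; apply/asboolP.
  exists (k * 2 ^+ m - l * 2 ^+ n), (n + m)%N.
  rewrite intrD intrN !intrM !rmorphXn /= exprD.
  by field; rewrite !two0.
- move=> /asboolP[k [n ->]] /asboolP[l [m ->]]; apply/asboolP.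
  exists (k * l), (n + m)%N; rewrite intrM exprD.
  by field; rewrite !two0.
Qed.

HB.instance Definition _ := GRing.isSubringClosed.Build rat dyadic dyadic_subring.

Record dyadic_rat :=
  DyadicRat { dyadic_val : rat; dyadic_valP : dyadic_val \in dyadic }.
HB.instance Definition _ := [isSub for dyadic_val].
HB.instance Definition _ := [Choice of dyadic_rat by <:].
HB.instance Definition _ := [SubChoice_isSubComNzRing of dyadic_rat by <:].

Lemma dyadic_exprz (i : int) : (2 : rat) ^ i \in dyadic.
Proof.
apply/asboolP; case: i => n.
  by exists (2 ^+ n), 0%N; rewrite rmorphXn /= expr0 divr1.
by exists 1, n.+1; rewrite mul1r.
Qed.

Definition pow2 (i : int) : dyadic_rat := DyadicRat (dyadic_exprz i).

Lemma pow2D i j : pow2 (i + j) = pow2 i * pow2 j.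
Proof. by apply: val_inj; rewrite rmorphM /= expfzDr. Qed.

Lemma pow2_0 : pow2 0 = 1.
Proof. by apply: val_inj; rewrite rmorph1. Qed.

Lemma pow2K i : pow2 i * pow2 (- i) = 1.
Proof. by rewrite -pow2D subrr pow2_0. Qed.

Lemma pow2_1 : pow2 1 = 2.
Proof. by apply: val_inj; rewrite rmorph_nat. Qed.

Lemma pow2N1 : 2 * pow2 (-1) = 1.
Proof. by rewrite -pow2_1 pow2K. Qed.

Lemma pow2_nat (n : nat) : pow2 n = 2 ^+ n.
Proof. by apply: val_inj; rewrite rmorphXn rmorph_nat. Qed.

Lemma pow2NK (n : nat) : pow2 (- n%:Z) * 2 ^+ n = 1.
Proof. by rewrite -pow2_nat mulrC pow2K. Qed.

Lemma dyadicE (a : dyadic_rat) : exists u : int * nat, a = u.1%:~R * pow2 (- u.2%:Z).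
Proof.
case/asboolP: (dyadic_valP a) => k [n ak]; exists (k, n); apply: val_inj.
by rewrite rmorphM rmorph_int /= [LHS]ak exprnN.
Qed.

Lemma int_dyadic_inj (k l : int) : k%:~R = l%:~R :> dyadic_rat -> k = l.
Proof. by move=> /(congr1 val); rewrite !rmorph_int => /intr_inj. Qed.

Definition dyadic_coef (a : dyadic_rat) : int * nat := sval (cid (dyadicE a)).
Lemma dyadic_coefE a : a = (dyadic_coef a).1%:~R * pow2 (- (dyadic_coef a).2%:Z).
Proof. exact: svalP (cid (dyadicE a)). Qed.

(** * Abels' group modulo its centre *)

(** The element with these coordinates is the class, modulo the centre, of
    (I + e12 E12 + e13 E13 + e24 E24 + e34 E34) (I + e23 E23) d, where d is the
    diagonal matrix (1, 2^-ds, 2^dt, 1).  The first factors form an abelian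
    normal subgroup V of the quotient, of which the remaining ones form a
    complement.  The generators of the diagonal part are chosen so that the
    weights of E12 and E34 are the two basis vectors; then E13, E24 and E23 have
    the weights (0,-1), (-1,0) and (-1,-1), and the corner E14 has weight 0. *)
Record abels := Abels
  { e12 : dyadic_rat; e13 : dyadic_rat; e24 : dyadic_rat; e34 : dyadic_rat;
    e23 : dyadic_rat; ds : int; dt : int }.

Definition abels_tuple g :=
  (e12 g, e13 g, e24 g, e34 g, e23 g, ds g, dt g).
Definition tuple_abels u :=
  let: (a, b, c, d, e, i, j) := u in Abels a b c d e i j.
Lemma abels_tupleK : cancel abels_tuple tuple_abels. Proof. by case. Qed.
HB.instance Definition _ := Choice.copy abels (can_type abels_tupleK).

Definition abels_one := Abels 0 0 0 0 0 0 0.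

Definition abels_mul g h :=
  Abels (e12 g + pow2 (ds g) * e12 h)
        (e13 g + pow2 (- dt g) * e13 h - e23 g * pow2 (ds g) * e12 h)
        (e24 g + pow2 (- ds g) * e24 h + e23 g * pow2 (dt g) * e34 h)
        (e34 g + pow2 (dt g) * e34 h)
        (e23 g + pow2 (- ds g) * pow2 (- dt g) * e23 h)
        (ds g + ds h) (dt g + dt h).

Definition abels_inv g :=
  Abels (- (pow2 (- ds g) * e12 g))
        (- (pow2 (dt g) * (e13 g + e23 g * e12 g)))
        (- (pow2 (ds g) * (e24 g - e23 g * e34 g)))
        (- (pow2 (- dt g) * e34 g))
        (- (pow2 (ds g) * pow2 (dt g) * e23 g))
        (- ds g) (- dt g).

Lemma abels_mulA : associative abels_mul.
Proof.
case=> a b c d e i j [a' b' c' d' e' i' j'] [a'' b'' c'' d'' e'' i'' j''].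
rewrite /abels_mul /= !opprD !pow2D !addrA.
by congr Abels; (ring || ring: (pow2K i) (pow2K j)).
Qed.

Lemma abels_mul1g : left_id abels_one abels_mul.
Proof.
by case=> a b c d e i j; rewrite /abels_mul /= oppr0 pow2_0; congr Abels; ring.
Qed.

Lemma abels_mulg1 : right_id abels_one abels_mul.
Proof. by case=> a b c d e i j; rewrite /abels_mul /=; congr Abels; ring. Qed.

Lemma abels_mulVg : left_inverse abels_one abels_inv abels_mul.
Proof.
case=> a b c d e i j; rewrite /abels_mul /= !opprK.
by congr Abels; (exact: addNr || ring: (pow2K i) (pow2K j)).
Qed.

Lemma abels_mulgV : right_inverse abels_one abels_inv abels_mul.
Proof.
case=> a b c d e i j; rewrite /abels_mul /=.
by congr Abels; (exact: addrN || ring: (pow2K i) (pow2K j)).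
Qed.

HB.instance Definition _ := isGroup.Build abels
  abels_mulA abels_mul1g abels_mulg1 abels_mulVg abels_mulgV.

(** The entry in the corner (1,4) of the product of the matrix representatives
    whose V-factor has entry 0 there: the 2-cocycle of Abels' group as a
    central extension of its quotient by Z[1/2]. *)
Definition corner_cocycle g h : rat :=
  val (e12 g * (pow2 (- ds g) * e24 h + e23 g * pow2 (dt g) * e34 h)
        + e13 g * (pow2 (dt g) * e34 h)).

(** The row (e12, e13) and the column (e24, e34) pair to the corner, and this
    pairing is invariant under the complement of V, which acts on row and
    column by mutually inverse matrices. *)
Lemma corner_cocycleP (g h k : abels) :
  corner_cocycle g h + corner_cocycle (g * h)%g k =
  corner_cocycle h k + corner_cocycle g (h * k)%g.
Proof.
rewrite /corner_cocycle -!raddfD; congr val.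
case: g h k => a b c d e i j [a' b' c' d' e' i' j'] [a'' b'' c'' d'' e'' i'' j''].
rewrite /= !opprD !pow2D.
ring: (pow2K i) (pow2K j).
Qed.

Lemma corner_cocycle_pairing (a b : dyadic_rat) :
  corner_cocycle (Abels a 0 0 0 0 0 0) (Abels 0 0 b 0 0 0 0) = val a * val b.
Proof.
rewrite /corner_cocycle -rmorphM; congr val => /=.
by rewrite oppr0 pow2_0; ring.
Qed.

(** * Integer and dyadic powers in a group *)

Section IntegerPowers.
Local Open Scope group_scope.
Variable L : groupType.
Implicit Types (x y g : L) (k l : int).

Definition zexp x k : L :=
  match k with Posz n => x ^+ n | Negz n => x ^- n.+1 end.

Lemma zexpS x k : zexp x (k + 1)%R = zexp x k * x.
Proof.
case: k => [n|[|n]].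
- by rewrite addrC -intS /= expgSr.
- by rewrite /= expg1 mulVg.
- rewrite NegzE [n.+2]lock -lock intS opprD addrAC addNr add0r -NegzE /=.
  by rewrite [in RHS]expgS invgM mulgVK.
Qed.

Lemma zexpB1 x k : zexp x (k - 1)%R = zexp x k * x^-1.
Proof. by rewrite -[in RHS](subrK 1%R k) zexpS mulgK. Qed.

Lemma zexpD x k l : zexp x (k + l)%R = zexp x k * zexp x l.
Proof.
elim/int_rect: l => [|n IHn|n IHn]; first by rewrite addr0 mulg1.
  by rewrite -addn1 PoszD addrA !zexpS IHn mulgA.
by rewrite -addn1 PoszD opprD addrA !zexpB1 IHn mulgA.
Qed.

Lemma zexpN x k : zexp x (- k)%R = (zexp x k)^-1.
Proof. by apply/esym/mulg1_eq; rewrite -zexpD subrr. Qed.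

Lemma zexpVg x k : zexp x^-1 k = zexp x (- k)%R.
Proof. by rewrite zexpN; case: k => n /=; rewrite expVgn. Qed.

Lemma zexpM2 x k : zexp (x ^+ 2) k = zexp x (k * 2)%R.
Proof.
have E n : (x ^+ 2) ^+ n = x ^+ (n * 2) by rewrite -expgnA mulnC.
case: k => n; first by rewrite -PoszM /= E.
by rewrite [in RHS]NegzE mulNr zexpN -PoszM /= E.
Qed.

Lemma zexpJ x g k : zexp x k ^ g = zexp (x ^ g) k.
Proof. by case: k => n /=; rewrite ?conjVg conjXg. Qed.

Lemma commute_zexp x g k : commute g x -> commute g (zexp x k).
Proof.
by move=> cgx; case: k => n /=; [|apply: commuteV]; apply: commuteX.
Qed.

Lemma commute_conj x y g : commute (x ^ g) (y ^ g) -> commute x y.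
Proof. by rewrite /commute -!conjMg => /conjg_inj. Qed.

Lemma commuteJ x y g : commute g x -> commute g y -> commute g (x ^ y).
Proof.
by move=> cx cy; rewrite conjgE; do !apply: commuteM => //; apply: commuteV.
Qed.

Lemma conj_commute x g : commute x g -> x ^ g = x.
Proof. by move=> cxg; rewrite conjgE cxg mulKg. Qed.

Lemma commute_commg x y g : commute g x -> commute g y -> commute g [~ x, y].
Proof.
by move=> cx cy; rewrite /commg; apply: commuteM (commuteV _) (commuteJ _ _).
Qed.

Lemma zexpA x k l : zexp (zexp x k) l = zexp x (k * l)%R.
Proof.
elim/int_rect: l => [|n IHn|n IHn]; first by rewrite mulr0.
  by rewrite -addn1 PoszD zexpS IHn mulrDr mulr1 zexpD.
by rewrite -addn1 PoszD opprD zexpB1 IHn mulrDr mulrN1 zexpD zexpN.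
Qed.

Lemma zexpMg x y k : commute x y -> zexp (x * y) k = zexp x k * zexp y k.
Proof.
move=> cxy; case: k => n /=; first exact: expgMn.
by rewrite expgMn // -invgM; congr (_ ^-1); apply: commuteX2.
Qed.

(** Conjugation by y multiplies x^k by the k-th power of [~ x, y], since the two
    commute; likewise with the roles of x^k and y exchanged. *)
Lemma commg_zexp x y k l : commute [~ x, y] x -> commute [~ x, y] y ->
  [~ zexp x k, zexp y l] = zexp [~ x, y] (k * l)%R.
Proof.
set w := [~ x, y] => cwx cwy.
have E : [~ zexp x k, y] = zexp w k.
  rewrite commgEl zexpJ (_ : x ^ y = x * w); last by rewrite /w commgEl mulVKg.
  by rewrite zexpMg ?mulKg //; apply: commute_sym.
have cy : commute y (zexp w k)^-1 by apply/commuteV/commute_zexp/commute_sym.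
rewrite commgEr conjVg zexpJ (_ : y ^ _ = y * (zexp w k)^-1).
  rewrite zexpMg // invgM mulgVK -zexpN zexpA -zexpN; congr zexp; ring.
by rewrite -E commgEr conjVg invgM invgK mulVKg.
Qed.

End IntegerPowers.

(* dpow is locked: otherwise unification unfolds it to a product and rewriting
   with associativity splits it. *)
Fact dpow_key : unit. Proof. by []. Qed.

Section DyadicPowers.
Local Open Scope group_scope.
Variables (L : groupType) (s x : L).
Hypothesis xs : x ^ s = x ^+ 2.

(** The value at a of the homomorphism from Z[1/2] that sends 1 to x and turns
    conjugation by s into multiplication by 2; k / 2^n goes to the conjugate of
    x^k by s^-n. *)
Definition dpow (a : dyadic_rat) : L :=
  locked_with dpow_key (zexp x (dyadic_coef a).1 ^ (s ^- (dyadic_coef a).2)).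

Lemma conj_zexp_iter k (n : nat) : zexp x k ^ (s ^+ n) = zexp x (k * 2 ^+ n)%R.
Proof.
elim: n k => [|n IHn] k; first by rewrite expg0 conjg1 expr0 mulr1.
by rewrite expgS conjgM zexpJ xs zexpM2 IHn exprS mulrA.
Qed.

Lemma dpowE (k : int) (n : nat) :
  dpow (k%:~R * pow2 (- n%:Z))%R = zexp x k ^ (s ^- n).
Proof.
rewrite /dpow unlock; set a := (_ * _)%R; have := dyadic_coefE a.
case: (dyadic_coef a) => l m /= E.
have {}E : (l * 2 ^+ n = k * 2 ^+ m)%R.
  apply: int_dyadic_inj; rewrite !intrM !rmorphXn /=.
  have -> : (l%:~R * 2 ^+ n = a * 2 ^+ n * 2 ^+ m)%R.
    by rewrite E; ring: (pow2NK m).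
  by rewrite /a; ring: (pow2NK n).
apply: (@conjg_inj _ (s ^+ (n + m))).
rewrite {1}addnC !expgnDr -!conjgM !mulKg !conj_zexp_iter.
by rewrite E.
Qed.

Lemma dpow_int (k : int) : dpow k%:~R%R = zexp x k.
Proof. by have := dpowE k 0; rewrite oppr0 pow2_0 mulr1 expg0 invg1 conjg1. Qed.

Lemma dpow1 : dpow 1%R = x.
Proof. exact: dpow_int 1%R. Qed.

Lemma dpowD a b : dpow (a + b)%R = dpow a * dpow b.
Proof.
have [[k n] ->] := dyadicE a; have [[l m] ->] := dyadicE b => /=.
have En : (k%:~R * pow2 (- n%:Z) =
           (k * 2 ^+ m)%:~R * pow2 (- (n + m)%N%:Z) :> dyadic_rat)%R.
  by rewrite PoszD opprD pow2D intrM rmorphXn /=; ring: (pow2NK m).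
have Em : (l%:~R * pow2 (- m%:Z) =
           (l * 2 ^+ n)%:~R * pow2 (- (n + m)%N%:Z) :> dyadic_rat)%R.
  by rewrite PoszD opprD pow2D intrM rmorphXn /=; ring: (pow2NK n).
by rewrite En Em -mulrDl -intrD !dpowE zexpD conjMg.
Qed.

Lemma dpow0 : dpow 0%R = 1.
Proof. exact: dpow_int 0%R. Qed.

Lemma dpowN a : dpow (- a)%R = (dpow a)^-1.
Proof. by apply/esym/mulg1_eq; rewrite -dpowD subrr dpow0. Qed.

Lemma dpowJ a : dpow a ^ s = dpow (2 * a)%R.
Proof.
have [[k n] ->] := dyadicE a; rewrite mulrA -[2%R]/(2%:~R)%R -intrM !dpowE.
rewrite -conjgM -[in RHS](mulrC k) -zexpM2 -xs -zexpJ -conjgM.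
by congr (_ ^ _); apply: commute_sym; apply: commuteV; apply: commuteX.
Qed.

Lemma dpowJV a : dpow a ^ (s^-1) = dpow (pow2 (-1) * a)%R.
Proof. by rewrite -[in LHS](mul1r a) -(pow2K 1) -mulrA pow2_nat -dpowJ conjgK. Qed.

Lemma dpowJz a k : dpow a ^ (zexp s k) = dpow (pow2 k * a)%R.
Proof.
elim/int_rect: k => [|n IHn|n IHn]; first by rewrite conjg1 pow2_0 mul1r.
  by rewrite -addn1 PoszD zexpS conjgM IHn dpowJ pow2D pow2_1 mulrA (mulrC 2%R).
rewrite -addn1 PoszD opprD zexpB1 conjgM IHn dpowJV pow2D.
by rewrite mulrA (mulrC (pow2 (-1))).
Qed.

Lemma commute_dpow g a : commute g s -> commute g x -> commute g (dpow a).
Proof.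
move=> cs cx; rewrite /dpow unlock; apply: commuteJ; first exact: commute_zexp.
by apply: commuteV; apply: commuteX.
Qed.

End DyadicPowers.

Section DyadicMorph.
Local Open Scope group_scope.
Variables (L K : groupType) (f : L -> K).
Hypothesis fF : {morph f : x y / x * y}.

Lemma morphg1 : f 1 = 1.
Proof. by apply: (@mulgI _ (f 1)); rewrite -fF !mulg1. Qed.

Lemma morphgV : {morph f : x / x^-1}.
Proof. by move=> x; apply/esym/mulg1_eq; rewrite -fF mulgV morphg1. Qed.

Lemma morph_zexp x k : f (zexp x k) = zexp (f x) k.
Proof.
have fX n : f (x ^+ n) = f x ^+ n.
  by elim: n => [|n IHn]; rewrite ?morphg1 // !expgS fF IHn.
by case: k => n /=; rewrite ?morphgV fX.
Qed.

Lemma morph_dpow s x a : f (dpow s x a) = dpow (f s) (f x) a.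
Proof.
rewrite /dpow !unlock !conjgE !fF !morphgV.
by rewrite -[s ^+ _]/(zexp s (Posz _)) !morph_zexp.
Qed.
End DyadicMorph.

(** * Commutators of dyadic powers *)

(** Here x has weight (1,0) and y has weight (-1,-1) under conjugation by s and
    t.  The weights are linearly independent, so a conjugation brings any
    prescribed pair of dyadic powers of x and y to integer powers; this is how
    relations between x and y propagate to all dyadic powers.  The same section
    applied to (z, y, t, s) serves the pair E34, E23. *)
Section DyadicCommutators.
Local Open Scope group_scope.
Variables (L : groupType) (x y s t : L).
Let w := [~ x, y].
Hypotheses (cst : commute s t) (xs : x ^ s = x ^+ 2) (cxt : commute x t).
Hypotheses (ys : y ^ s^-1 = y ^+ 2) (yt : y ^ t^-1 = y ^+ 2).
Hypotheses (cwx : commute w x) (cwy : commute w y).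

Lemma conj_commg_t : w ^ t^-1 = w ^+ 2.
Proof.
rewrite /w conjRg yt (conj_commute (commuteV cxt)).
by rewrite (@commg_zexp _ x y 1%R 2%R).
Qed.

Lemma y_conj_st : y ^ s = y ^ t.
Proof.
apply: (@conjg_inj _ (s^-1 * t^-1)); rewrite -!conjgM mulVKg mulgA.
by rewrite (commuteV (commute_sym cst)) mulgK yt ys.
Qed.

(** The weight of w in the direction of s is 1 - 1 = 0: conjugating by s turns
    [~ x, y] into [~ x^2, y^(1/2)]. *)
Lemma commute_commg_s : commute w s.
Proof.
suff E : w ^ s = w by rewrite /commute -{2}E conjgE mulVKg.
have -> : w ^ s = [~ x ^+ 2, y] ^ t.
  by rewrite !conjRg xs y_conj_st conjXg (conj_commute cxt).
rewrite (@commg_zexp _ x y 2%R 1%R) // -[zexp _ _]/(w ^+ 2).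
by rewrite -conj_commg_t conjgKV.
Qed.

Lemma commute_dpow_commg_x a b : commute (dpow t^-1 w a) (dpow s x b).
Proof.
have H : commute (dpow s x b) w.
  by apply: commute_sym; apply: commute_dpow => //; apply: commute_commg_s.
apply: commute_sym; apply: commute_dpow => //.
by apply: commuteV; apply: commute_sym; apply: commute_dpow; apply: commute_sym.
Qed.

(** Conjugation by s and t agree on y, so either may be used to define its
    dyadic powers. *)
Lemma dpow_weight_eq a : dpow t^-1 y a = dpow s^-1 y a.
Proof.
have [[k n] ->] := dyadicE a; rewrite !dpowE // !zexpJ.
congr zexp; rewrite -!expVgn !invgK.
elim: n => [|n IHn]; first by rewrite !conjg1.
rewrite !expgSr !conjgM IHn.
have C : commute t (s ^+ n) by apply: commuteX; apply: commute_sym.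
rewrite -!conjgM -C.
have -> : s ^+ n * s = s * s ^+ n by rewrite -expgSr expgS.
by rewrite !conjgM y_conj_st.
Qed.

(** Integer powers of w commute with all dyadic powers of y, as w commutes with
    s and y; conjugation by t, which normalises the dyadic powers of y, gives the
    dyadic powers of w. *)
Lemma commute_dpow_commg_y a b : commute (dpow t^-1 w a) (dpow s^-1 y b).
Proof.
have [[k n] ->] := dyadicE a; rewrite dpowE; last exact: conj_commg_t.
rewrite -dpow_weight_eq; apply: (@commute_conj _ _ _ (t^-1 ^+ n)).
rewrite -conjgM mulVg conjg1.
have -> : t^-1 ^+ n = zexp t^-1 n by [].
rewrite dpowJz // dpow_weight_eq.
apply/commute_sym/commute_zexp/commute_sym/commute_dpow => //.
exact/commuteV/commute_commg_s.
Qed.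

Lemma commg_dpow a b :
  [~ dpow s x a, dpow s^-1 y b] = dpow t^-1 w (a * b)%R.
Proof.
have [[k n] ->] := dyadicE a; have [[l m] ->] := dyadicE b => /=.
(* conjugation by h^-1 has factor 2^n on x and 2^-n 2^(n+m) = 2^m on y *)
pose h := t ^+ (n + m) * s ^- n.
have tE : t ^+ (n + m) = zexp t^-1 (- (n + m)%N%:Z)%R by rewrite zexpVg opprK.
have -> : dpow s x (k%:~R * pow2 (- n%:Z))%R = zexp x k ^ h.
  rewrite dpowE // /h conjgM; congr (_ ^ _).
  by apply/esym/conj_commute/commuteX/commute_sym/commute_zexp/commute_sym.
have -> : dpow s^-1 y (l%:~R * pow2 (- m%:Z))%R = zexp y l ^ h.
  rewrite -(dpow_int ys) /h conjgM -(dpow_weight_eq l%:~R).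
  rewrite tE dpowJz // dpow_weight_eq.
  have -> : s ^- n = zexp s^-1 n by rewrite zexpVg zexpN.
  rewrite dpowJz //; congr dpow.
  by rewrite PoszD opprD pow2D; ring: (pow2K n).
rewrite -conjRg commg_zexp // -/w /h conjgM.
rewrite tE -(dpow_int conj_commg_t) dpowJz ?conj_commg_t //.
rewrite conj_commute; last first.
  apply: commuteV; apply: commuteX; apply: commute_sym; apply: commute_dpow.
    exact: commuteV.
  exact/commute_sym/commute_commg_s.
congr dpow; rewrite PoszD opprD pow2D intrM; ring.
Qed.

End DyadicCommutators.

(** * Relations satisfied by lifts of the generators *)

(** A case of the Hall-Witt identity, from rearranging p q r in two ways. *)
Lemma commg_exchange (L : groupType) (p q r : L) :
  commute p q -> commute p [~ p, r]%g -> commute q [~ q, r]%g ->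
  commute [~ p, r]%g [~ q, r]%g ->
  [~ p, [~ q, r]]%g = [~ q, [~ p, r]]%g.
Proof.
have := commgC p r; have := commgC q r.
move: [~ p, r]%g [~ q, r]%g => a b Eq Ep cpq cpa cqb cab.
have E1 : (p * q * r = r * p * a * q * b)%g.
  by rewrite -mulgA Eq !mulgA Ep.
have E2 : (p * q * r = r * q * b * p * a)%g.
  by rewrite cpq -mulgA Ep !mulgA Eq.
have := etrans (esym E1) E2; rewrite -!mulgA => /mulgI E.
have cu : commute a [~ p, b]%g by apply: commute_commg => //; apply: commute_sym.
have cv : commute b [~ q, a]%g by apply: commute_commg => //; apply: commute_sym.
have F1 : (a * (q * b) = q * (a * (b * [~ q, a]^-1)))%g.
  by rewrite (commuteV cv) !mulgA (commgC q a) mulgK.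
have F2 : (b * (p * a) = p * (b * (a * [~ p, b]^-1)))%g.
  by rewrite (commuteV cu) !mulgA (commgC p b) mulgK.
move: E; rewrite F1 F2 [LHS]mulgA cpq -[LHS]mulgA => /mulgI/mulgI.
by rewrite mulgA cab -mulgA => /mulgI/mulgI/invg_inj.
Qed.

Section Presentation.
Local Open Scope group_scope.
Variables (L : groupType) (x y z s t : L).

(** The relations of G between the classes of I + E12, I + E23, I + E34 and the
    two diagonal generators s and t; w and v stand for I + E13 and I - E24. *)
Definition relators : seq L :=
  let w := [~ x, y] in let v := [~ z, y] in
  [:: [~ s, t]; [~ x, t]; [~ z, s]; [~ x, z];
      x ^ s / x ^+ 2; z ^ t / z ^+ 2; y ^ s^-1 / y ^+ 2; y ^ t^-1 / y ^+ 2;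
      [~ w, x]; [~ w, y]; [~ v, z]; [~ v, y]; [~ w, v]; [~ x, v]].

(** The root subgroups spanned by x, ..., t.  X24 a stands for I - a E24, the sign
    being that of [~ z, y]; this choice makes the presentation symmetric under
    exchanging (x, s) with (z, t). *)
Definition X12 := dpow s x.
Definition X34 := dpow t z.
Definition X23 := dpow s^-1 y.
Definition X13 := dpow t^-1 [~ x, y].
Definition X24 := dpow s^-1 [~ z, y].

(** The factorisation defining the coordinates of g; s and t have the
    coordinates ds = -1 and dt = -1, because they act by conjugation on the
    right. *)
Definition abels_word (g : abels) : L :=
  X12 (e12 g) * X13 (e13 g) * X24 (- e24 g) * X34 (e34 g) * X23 (e23 g)
  * (zexp s (- ds g) * zexp t (- dt g)).

(** In Abels' group this is the central element I - a E14. *)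
Definition central_word (a : dyadic_rat) : L := [~ x, X24 a].

Hypothesis rel : forall r, r \in relators -> r = 1.

Let relc g h : [~ g, h] \in relators -> commute g h.
Proof. by move=> /rel/eqP/commgP. Qed.
Let relq g h : g / h \in relators -> g = h.
Proof. by move=> /rel/divg1_eq. Qed.

Ltac in_relators := rewrite !inE eqxx ?orbT.

Let cst : commute s t. Proof. by apply: relc; in_relators. Qed.
Let cts : commute t s. Proof. exact: commute_sym. Qed.
Let cxt : commute x t. Proof. by apply: relc; in_relators. Qed.
Let czs : commute z s. Proof. by apply: relc; in_relators. Qed.
Let cxz : commute x z. Proof. by apply: relc; in_relators. Qed.
Let xs : x ^ s = x ^+ 2. Proof. by apply: relq; in_relators. Qed.
Let zt : z ^ t = z ^+ 2. Proof. by apply: relq; in_relators. Qed.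
Let ys : y ^ s^-1 = y ^+ 2. Proof. by apply: relq; in_relators. Qed.
Let yt : y ^ t^-1 = y ^+ 2. Proof. by apply: relq; in_relators. Qed.
Let cwx : commute [~ x, y] x. Proof. by apply: relc; in_relators. Qed.
Let cwy : commute [~ x, y] y. Proof. by apply: relc; in_relators. Qed.
Let cvz : commute [~ z, y] z. Proof. by apply: relc; in_relators. Qed.
Let cvy : commute [~ z, y] y. Proof. by apply: relc; in_relators. Qed.
Let cwv : commute [~ x, y] [~ z, y]. Proof. by apply: relc; in_relators. Qed.
Let cxv : commute x [~ z, y]. Proof. by apply: relc; in_relators. Qed.

Let ws : commute [~ x, y] s. Proof. exact: (commute_commg_s cst). Qed.
Let vt : commute [~ z, y] t. Proof. exact: (commute_commg_s cts). Qed.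
Let wt : [~ x, y] ^ t^-1 = [~ x, y] ^+ 2. Proof. exact: (conj_commg_t cxt). Qed.
Let vs : [~ z, y] ^ s^-1 = [~ z, y] ^+ 2. Proof. exact: (conj_commg_t czs). Qed.
Let X23t a : dpow t^-1 y a = X23 a. Proof. exact: (dpow_weight_eq cst). Qed.

Let c1213 a b : commute (X12 a) (X13 b).
Proof. exact/commute_sym/(commute_dpow_commg_x cst). Qed.
Let c3424 a b : commute (X34 a) (X24 b).
Proof. exact/commute_sym/(commute_dpow_commg_x cts). Qed.
Let c2313 a b : commute (X23 a) (X13 b).
Proof. exact/commute_sym/(commute_dpow_commg_y cst). Qed.
Let c2324 a b : commute (X23 a) (X24 b).
Proof. by rewrite -X23t; apply/commute_sym/(commute_dpow_commg_y cts). Qed.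
Let c1223 a b : [~ X12 a, X23 b] = X13 (a * b)%R.
Proof. exact: (commg_dpow cst). Qed.
Let c3423 a b : [~ X34 a, X23 b] = X24 (a * b)%R.
Proof. by rewrite -X23t; apply: (commg_dpow cts). Qed.

Let c1234 a b : commute (X12 a) (X34 b).
Proof.
apply: commute_dpow; apply: commute_sym; apply: commute_dpow => //;
  exact: commute_sym.
Qed.
Let c1324 a b : commute (X13 a) (X24 b).
Proof.
apply: commute_dpow; [apply: commuteV|]; apply: commute_sym; apply: commute_dpow.
- exact/commuteV.
- exact: commute_sym.
- exact/commuteV.
- exact: commute_sym.
Qed.

(** The corner can be reached through E12 and E24 or through E13 and E34. *)
Lemma corner a b c : [~ X12 a, X24 (b * c)%R] = [~ X34 c, X13 (a * b)%R].
Proof.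
rewrite -c1223 mulrC -c3423; apply: commg_exchange; rewrite ?c1223 ?c3423 //.
Qed.

Let X12_1 : X12 1%R = x. Proof. exact: dpow1. Qed.

(** The exchange formula alone implies that the corner commutators depend only
    on the product of the two coordinates. *)
Lemma corner12E a b : [~ X12 a, X24 b] = central_word (a * b)%R.
Proof.
rewrite /central_word -X12_1 -[b in LHS]mulr1 corner.
by rewrite -[(a * b)%R in RHS]mulr1 corner mul1r.
Qed.

Lemma corner34E a b : [~ X34 a, X13 b] = central_word (b * a)%R.
Proof. by rewrite -[b in LHS]mul1r -corner corner12E mul1r. Qed.

Lemma central_wordD a b :
  central_word (a + b)%R = central_word a * central_word b.
Proof.
(* written as a commutator of X34 and X13, a corner element commutes with X24 *)
have cB c d : commute (X24 c) (central_word d).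
  rewrite -[d]mulr1 -corner34E; apply: commute_commg; apply: commute_sym.
    exact: c3424.
  exact: c1324.
have X24D : X24 (b + a)%R = X24 b * X24 a by rewrite /X24 dpowD.
have E : x ^ X24 b = x * central_word b by rewrite /central_word commgEl mulVKg.
rewrite {1}/central_word addrC X24D commgEl conjgM E conjMg mulgA -commgEl.
by rewrite (conj_commute (commute_sym (cB _ _))).
Qed.

Lemma central_word1 : central_word 1%R = 1.
Proof. by rewrite /central_word /X24 dpow1 //; apply/eqP/commgP. Qed.

Definition torus (i j : int) := zexp s (- i)%R * zexp t (- j)%R.
Definition vword a b c d := X12 a * X13 b * X24 c * X34 d.

Let torusV i j : (torus i j)^-1 = zexp t j * zexp s i.
Proof. by rewrite invgM -!zexpN !opprK. Qed.

Let zexp_inv (g : L) k : zexp g k = zexp g^-1 (- k)%R.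
Proof. by rewrite zexpVg opprK. Qed.

Let torusD i j i' j' : torus i j * torus i' j' = torus (i + i') (j + j').
Proof.
have C : commute (zexp t (- j)%R) (zexp s (- i')%R).
  by apply: commute_zexp; apply: commute_sym; apply: commute_zexp.
by rewrite /torus -mulgA [zexp t _ * _]mulgA C !opprD !zexpD !mulgA.
Qed.

Let X12J i j a : X12 a ^ (torus i j)^-1 = X12 (pow2 i * a)%R.
Proof.
rewrite torusV conjgM [X12 a ^ _]conj_commute ?dpowJz //.
apply: commute_zexp; apply: commute_sym; apply: commute_dpow => //;
  exact: commute_sym.
Qed.

Let X34J i j a : X34 a ^ (torus i j)^-1 = X34 (pow2 j * a)%R.
Proof.
rewrite torusV conjgM dpowJz // conj_commute //.
apply: commute_zexp; apply: commute_sym; apply: commute_dpow => //;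
  exact: commute_sym.
Qed.

Let X13J i j a : X13 a ^ (torus i j)^-1 = X13 (pow2 (- j) * a)%R.
Proof.
rewrite torusV conjgM zexp_inv dpowJz // conj_commute //.
apply: commute_zexp; apply: commute_sym; apply: commute_dpow.
  exact: commuteV.
exact: commute_sym.
Qed.

Let X24J i j a : X24 a ^ (torus i j)^-1 = X24 (pow2 (- i) * a)%R.
Proof.
rewrite torusV conjgM [X24 a ^ _]conj_commute; last first.
  apply: commute_zexp; apply: commute_sym; apply: commute_dpow.
    exact: commuteV.
  exact: commute_sym.
by rewrite zexp_inv dpowJz.
Qed.

Let X23J i j a : X23 a ^ (torus i j)^-1 = X23 (pow2 (- i) * pow2 (- j) * a)%R.
Proof.
by rewrite torusV conjgM zexp_inv -X23t dpowJz // X23t zexp_inv dpowJz // mulrA.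
Qed.

Let dpow_zero :
  ((X12 0 = 1) * (X13 0 = 1) * (X24 0 = 1) * (X34 0 = 1) * (X23 0 = 1))%type.
Proof. by rewrite /X12 /X13 /X24 /X34 /X23 !dpow0. Qed.

Lemma abels_word_x : abels_word (Abels 1 0 0 0 0 0 0)%R = x.
Proof. by rewrite /abels_word /= !oppr0 !dpow_zero X12_1 !mulg1. Qed.

Lemma abels_word_y : abels_word (Abels 0 0 0 0 1 0 0)%R = y.
Proof.
by rewrite /abels_word /= !oppr0 !dpow_zero /X23 dpow1 // !mulg1 !mul1g.
Qed.

Lemma abels_word_z : abels_word (Abels 0 0 0 1 0 0 0)%R = z.
Proof.
by rewrite /abels_word /= !oppr0 !dpow_zero /X34 dpow1 // !mulg1 !mul1g.
Qed.

Lemma abels_word_s : abels_word (Abels 0 0 0 0 0 (-1) 0)%R = s.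
Proof. by rewrite /abels_word /= !oppr0 !dpow_zero !mulg1 !mul1g. Qed.

Lemma abels_word_t : abels_word (Abels 0 0 0 0 0 0 (-1))%R = t.
Proof. by rewrite /abels_word /= !oppr0 !dpow_zero !mulg1 !mul1g. Qed.

Section Hom.
Hypothesis central1 : forall a, central_word a = 1.

Let c1224 a b : commute (X12 a) (X24 b).
Proof. by apply/commgP; rewrite corner12E central1. Qed.
Let c3413 a b : commute (X34 a) (X13 b).
Proof. by apply/commgP; rewrite corner34E central1. Qed.

Let vwordD a b c d a' b' c' d' :
  vword a b c d * vword a' b' c' d' =
  vword (a + a') (b + b') (c + c') (d + d').
Proof.
have ACA (p q p' q' : L) :
    commute q p' -> (p * q) * (p' * q') = (p * p') * (q * q').
  by move=> C; rewrite -!mulgA (mulgA q) C -!mulgA.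
rewrite /vword /X12 /X13 /X24 /X34 !dpowD //.
rewrite -!/(X12 _) -!/(X34 _) -!/(X13 _) -!/(X24 _).
rewrite [LHS]ACA; last by do !apply: commuteM => //; apply: commute_sym.
congr (_ * _).
rewrite [LHS]ACA; last by do !apply: commuteM => //; apply: commute_sym.
by congr (_ * _); rewrite [LHS]ACA //; apply: commute_sym.
Qed.

Let vwordJ_torus i j a b c d : vword a b c d ^ (torus i j)^-1 =
  vword (pow2 i * a)%R (pow2 (- j) * b)%R (pow2 (- i) * c)%R (pow2 j * d)%R.
Proof. by rewrite !conjMg X12J X13J X24J X34J. Qed.

Let vwordJ_X23 e a b c d : vword a b c d ^ (X23 e)^-1 =
  vword a (b - e * a)%R (c - e * d)%R d.
Proof.
have C (g h : L) : g ^ h = g * [~ g, h] by rewrite commgEl mulVKg.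
have -> : (X23 e)^-1 = X23 (- e)%R by rewrite /X23 dpowN.
rewrite !conjMg [X13 _ ^ _]conj_commute; last exact: commute_sym.
rewrite [X24 _ ^ _]conj_commute; last exact: commute_sym.
rewrite !C c1223 c3423 /vword.
rewrite [X34 _ * _]c3424 !mulgA -[X12 _ * _ * X13 _]mulgA.
rewrite -[_ * X24 _ * X24 _]mulgA.
by rewrite /X13 /X24 -!dpowD // !mulrN ![(_ * e)%R]mulrC ![(- _ + b)%R]addrC.
Qed.

Lemma abels_wordE g : abels_word g =
  vword (e12 g) (e13 g) (- e24 g) (e34 g) * (X23 (e23 g) * torus (ds g) (dt g)).
Proof. by rewrite mulgA. Qed.

(** The coordinates multiply in G as in the semidirect product of V with its
    complement; once the corner commutators vanish, the elements X12, X13, X24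
    and X34 commute with each other, and the complement acts on them by the
    formulas vwordJ_torus and vwordJ_X23. *)
Lemma abels_wordM : {morph abels_word : g h / g * h}.
Proof.
move=> g h; rewrite !abels_wordE.
set Q := X23 (e23 g) * _.
rewrite -[RHS]mulgA (mulgA Q).
have QV u : Q * u = (u ^ (torus (ds g) (dt g))^-1) ^ (X23 (e23 g))^-1 * Q.
  by rewrite -conjgM -invgM -conjgCV.
rewrite QV vwordJ_torus vwordJ_X23 -(mulgA _ Q) [RHS]mulgA vwordD.
have -> : Q * (X23 (e23 h) * torus (ds h) (dt h)) =
    X23 (e23 (g * h)) * torus (ds (g * h)) (dt (g * h)).
  rewrite /Q -[LHS]mulgA (mulgA (torus _ _) (X23 _)).
  have -> : torus (ds g) (dt g) * X23 (e23 h) =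
     X23 (pow2 (- ds g) * pow2 (- dt g) * e23 h)%R * torus (ds g) (dt g).
    by rewrite -X23J -conjgCV.
  by rewrite -(mulgA (X23 _)) torusD (mulgA (X23 _)) /X23 -dpowD.
congr (vword _ _ _ _ * _) => /=; ring.
Qed.

End Hom.
End Presentation.

(** * The generators of Abels' group *)

Section DyadicUnique.
Local Open Scope group_scope.
Variables (L : groupType) (s x : L) (u : dyadic_rat -> L).
Hypotheses (uD : forall a b, u (a + b)%R = u a * u b) (u1 : u 1%R = x).
Hypothesis us : forall a, u a ^ s = u (2 * a)%R.

(** Used to identify the root subgroups in a group where they are known
    explicitly. *)
Lemma dpow_unique : dpow s x =1 u.
Proof.
have xs : x ^ s = x ^+ 2 by rewrite -u1 us mulr2n mulrDl mul1r uD.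
have u0 : u 0%R = 1 by apply: (@mulgI _ (u 0%R)); rewrite -uD addr0 mulg1.
have uN a : u (- a)%R = (u a)^-1 by apply/esym/mulg1_eq; rewrite -uD subrr.
have uk (k : int) : u k%:~R%R = zexp x k.
  elim/int_rect: k => [|n IHn|n IHn]; first exact: u0.
    by rewrite -addn1 PoszD intrD uD IHn zexpS u1.
  by rewrite -addn1 PoszD opprD intrD uD IHn intrN uN u1 zexpB1.
have usn (n : nat) a : u a ^ (s ^+ n) = u (2 ^+ n * a)%R.
  elim: n a => [|n IHn] a; first by rewrite expg0 conjg1 expr0 mul1r.
  by rewrite expgS conjgM us IHn exprSr mulrA.
move=> a; have [[k n] ->] := dyadicE a; rewrite dpowE // -uk /=.
apply: (@conjg_inj _ (s ^+ n)); rewrite -conjgM mulVg conjg1 usn.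
by congr u; ring: (pow2NK n).
Qed.

End DyadicUnique.

Definition gx := Abels 1 0 0 0 0 0 0.
Definition gy := Abels 0 0 0 0 1 0 0.
Definition gz := Abels 0 0 0 1 0 0 0.
Definition gs := Abels 0 0 0 0 0 (-1) 0.
Definition gt := Abels 0 0 0 0 0 0 (-1).

Lemma abels_mulE a b c d e i j a' b' c' d' e' i' j' :
  (Abels a b c d e i j * Abels a' b' c' d' e' i' j')%g =
  Abels (a + pow2 i * a') (b + pow2 (- j) * b' - e * pow2 i * a')
        (c + pow2 (- i) * c' + e * pow2 j * d') (d + pow2 j * d')
        (e + pow2 (- i) * pow2 (- j) * e') (i + i') (j + j').
Proof. by []. Qed.

Ltac abels_eq :=
  rewrite /gx /gy /gz /gs /gt ?expg2 !abels_mulE /=;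
  rewrite ?(addr0, add0r, subr0, oppr0, opprK, pow2_0, pow2_1);
  rewrite ?(mul1r, mulr1, mul0r, mulr0);
  congr Abels; by [|ring|ring: pow2N1].

Lemma commg_xy : [~ gx, gy]%g = Abels 0 1 0 0 0 0 0.
Proof. by apply: (@mulgI _ (gy * gx)%g); rewrite -commgC; abels_eq. Qed.

Lemma commg_zy : [~ gz, gy]%g = Abels 0 0 (-1) 0 0 0 0.
Proof. by apply: (@mulgI _ (gy * gz)%g); rewrite -commgC; abels_eq. Qed.

Lemma relators_eq1 (L : groupType) (x y z s t w v : L) :
  [~ x, y]%g = w -> [~ z, y]%g = v ->
  commute s t -> commute x t -> commute z s -> commute x z ->
  (x * s = s * x ^+ 2)%g -> (z * t = t * z ^+ 2)%g ->
  (s * y = y ^+ 2 * s)%g -> (t * y = y ^+ 2 * t)%g ->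
  commute w x -> commute w y -> commute v z -> commute v y ->
  commute w v -> commute x v ->
  forall r, r \in relators x y z s t -> r = 1%g.
Proof.
move=> <- <- H1 H2 H3 H4 H5 H6 H7 H8 H9 H10 H11 H12 H13 H14.
have C (g h : L) : commute g h -> [~ g, h]%g = 1%g.
  by move=> gh; apply/eqP/commgP.
have Q (g h k : L) : (g * h)%g = (h * k)%g -> (g ^ h / k)%g = 1%g.
  by move=> gh; rewrite conjgE gh mulKg mulgV.
have QV (g h k : L) : (h * g)%g = (k * h)%g -> (g ^ h^-1 / k)%g = 1%g.
  by move=> gh; rewrite conjgE invgK mulgA gh mulgK mulgV.
suff /allP H : all (pred1 1%g) (relators x y z s t) by move=> r /H/eqP.
rewrite /= !(C _ _ H1, C _ _ H2, C _ _ H3, C _ _ H4).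
rewrite (Q _ _ _ H5) (Q _ _ _ H6) (QV _ _ _ H7) (QV _ _ _ H8).
rewrite !(C _ _ H9, C _ _ H10, C _ _ H11, C _ _ H12, C _ _ H13, C _ _ H14).
by rewrite !eqxx.
Qed.

Lemma abels_relators r : r \in relators gx gy gz gs gt -> r = 1%g.
Proof.
apply: (relators_eq1 commg_xy commg_zy); rewrite /commute.
all: abels_eq.
Qed.

Lemma X24_abels a : X24 gy gz gs a = Abels 0 0 (- a) 0 0 0 0.
Proof.
apply: (dpow_unique (u := fun a => Abels 0 0 (- a) 0 0 0 0)) => [b c||b].
- by abels_eq.
- by rewrite commg_zy.
by apply: (@mulIg _ gs); rewrite -conjgCV; abels_eq.
Qed.

Lemma central_word_abels a : central_word gx gy gz gs a = 1%g.
Proof. by apply/eqP/commgP; rewrite X24_abels /commute; abels_eq. Qed.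

Lemma abels_wordK g : abels_word gx gy gz gs gt g = g.
Proof.
have E12 a : X12 gx gs a = Abels a 0 0 0 0 0 0.
  apply: (dpow_unique (u := fun a => Abels a 0 0 0 0 0 0)) => // [b c|b].
    by abels_eq.
  apply: (@mulgI _ gs); rewrite -conjgC; abels_eq.
have E34 a : X34 gz gt a = Abels 0 0 0 a 0 0 0.
  apply: (dpow_unique (u := fun a => Abels 0 0 0 a 0 0 0)) => // [b c|b].
    by abels_eq.
  apply: (@mulgI _ gt); rewrite -conjgC; abels_eq.
have E23 a : X23 gy gs a = Abels 0 0 0 0 a 0 0.
  apply: (dpow_unique (u := fun a => Abels 0 0 0 0 a 0 0)) => // [b c|b].
    by abels_eq.
  apply: (@mulIg _ gs); rewrite -conjgCV; abels_eq.
have E13 a : X13 gx gy gt a = Abels 0 a 0 0 0 0 0.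
  apply: (dpow_unique (u := fun a => Abels 0 a 0 0 0 0 0)) => [b c||b].
  - by abels_eq.
  - by rewrite commg_xy.
  by apply: (@mulIg _ gt); rewrite -conjgCV; abels_eq.
have Es k : zexp gs k = Abels 0 0 0 0 0 (- k) 0.
  elim/int_rect: k => [|n IHn|n IHn]; first by rewrite oppr0.
    by rewrite -addn1 PoszD zexpS IHn opprD; abels_eq.
  rewrite -addn1 PoszD opprD zexpB1 IHn; apply: (@mulIg _ gs); rewrite mulgVK.
  by rewrite opprD !opprK; abels_eq; rewrite addrK.
have Et k : zexp gt k = Abels 0 0 0 0 0 0 (- k).
  elim/int_rect: k => [|n IHn|n IHn]; first by rewrite oppr0.
    by rewrite -addn1 PoszD zexpS IHn opprD; abels_eq.
  rewrite -addn1 PoszD opprD zexpB1 IHn; apply: (@mulIg _ gt); rewrite mulgVK.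
  by rewrite opprD !opprK; abels_eq; rewrite addrK.
rewrite /abels_word E12 E13 X24_abels E34 E23 Es Et.
by case: g => a b c d e i j /=; abels_eq.
Qed.

(** * Free modules and cokernels *)

Section FreeModules.
Variables (A : pzRingType) (n : nat).

Definition lincomb (M : lmodType A) (v : 'I_n -> M) (r : 'rV[A]_n) : M :=
  \sum_i r 0 i *: v i.

Lemma lincomb_is_linear (M : lmodType A) (v : 'I_n -> M) : linear (lincomb v).
Proof.
move=> a r r'; rewrite /lincomb scaler_sumr -big_split /=; apply: eq_bigr => i _.
by rewrite !mxE scalerDl scalerA.
Qed.
HB.instance Definition _ (M : lmodType A) (v : 'I_n -> M) :=
  GRing.isLinear.Build A 'rV[A]_n M *:%R (lincomb v) (lincomb_is_linear v).

Lemma row_lincomb (r : 'rV[A]_n) : r = lincomb (fun i => delta_mx 0 i) r.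
Proof. exact: row_sum_delta. Qed.

Lemma lincomb_linear (M : lmodType A) (f : {linear 'rV[A]_n -> M}) r :
  f r = lincomb (fun i => f (delta_mx 0 i)) r.
Proof.
by rewrite {1}(row_lincomb r) linear_sum; apply: eq_bigr => i _; rewrite linearZ.
Qed.

Lemma free_projective : projective 'rV[A]_n.
Proof.
move=> M N p f p_surj.
have [v vE] := choice (fun i => p_surj (f (delta_mx 0 i))).
exists (lincomb v) => r.
rewrite [RHS]lincomb_linear linear_sum; apply: eq_bigr => i _.
by rewrite linearZ vE.
Qed.

Lemma free_finitely_generated : finitely_generated 'rV[A]_n.
Proof.
exists n, (fun i => delta_mx 0 i) => r; exists (fun i => r 0 i).
exact: row_lincomb.
Qed.

(** The dual basis of a finitely generated projective module: the surjection from
    a free module given by generators splits. *)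
Lemma projective_dual_basis (P : lmodType A) (v : 'I_n -> P) :
  projective P -> (forall x, exists a : 'I_n -> A, x = \sum_i a i *: v i) ->
  exists phi : {linear P -> 'rV[A]_n}, forall x, lincomb v (phi x) = x.
Proof.
move=> Pproj vgen; apply: (Pproj _ _ (lincomb v) idfun) => x.
have [a ->] := vgen x; exists (\row_i a i).
by apply: eq_bigr => i _; rewrite mxE.
Qed.

End FreeModules.

Section Cokernel.
Variables (A : pzRingType) (V W : lmodType A) (f : {linear W -> V}).

Definition image_pred : {pred V} := fun v => `[< exists w, f w = v >].

Lemma image_zmod_closed : zmod_closed image_pred.
Proof.
split=> [|u v /asboolP[x <-] /asboolP[y <-]]; apply/asboolP.
  by exists 0; rewrite linear0.
by exists (x - y); rewrite linearB.
Qed.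
HB.instance Definition _ :=
  GRing.isZmodClosed.Build V image_pred image_zmod_closed.

Definition coker := Quotient.quot (image_pred : zmodClosed V).
HB.instance Definition _ := Choice.on coker.
HB.instance Definition _ := GRing.Zmodule.on coker.

Definition coker_pi (v : V) : coker :=
  \pi_(Quotient.quot (image_pred : zmodClosed V))%qT v.

Lemma coker_piB : zmod_morphism coker_pi.
Proof. exact: raddfB. Qed.
HB.instance Definition _ := GRing.isZmodMorphism.Build V coker coker_pi coker_piB.

Lemma coker_pi_eq0 v : coker_pi v = 0 <-> exists w, f w = v.
Proof.
rewrite -(raddf0 coker_pi); split => [/eqP|[w <-]]; last first.
  by apply/eqP; rewrite -Quotient.idealrBE subr0; apply/asboolP; exists w.
by rewrite -Quotient.idealrBE subr0 => /asboolP.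
Qed.

Lemma coker_pi_surj (q : coker) : exists v, coker_pi v = q.
Proof. by exists (repr q); apply: reprK. Qed.

Definition coker_scale (a : A) (q : coker) : coker := coker_pi (a *: repr q).

Lemma coker_scaleE a v : coker_scale a (coker_pi v) = coker_pi (a *: v).
Proof.
apply/eqP; rewrite -subr_eq0 -raddfB -scalerBr; apply/eqP.
have /coker_pi_eq0[w fw] : coker_pi (repr (coker_pi v) - v) = 0.
  by rewrite raddfB /= [X in X - _]reprK subrr.
by apply/coker_pi_eq0; exists (a *: w); rewrite linearZ fw.
Qed.

Lemma coker_scaleA a b q :
  coker_scale a (coker_scale b q) = coker_scale (a * b) q.
Proof. by have [v <-] := coker_pi_surj q; rewrite !coker_scaleE scalerA. Qed.
Lemma coker_scale1 : left_id 1 coker_scale.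
Proof.
by move=> q; have [v <-] := coker_pi_surj q; rewrite !coker_scaleE scale1r.
Qed.
Lemma coker_scaleDr : right_distributive coker_scale +%R.
Proof.
move=> a q r; have [v <-] := coker_pi_surj q; have [u <-] := coker_pi_surj r.
by rewrite -raddfD !coker_scaleE scalerDr raddfD.
Qed.
Lemma coker_scaleDl q : {morph coker_scale^~ q : a b / a + b}.
Proof.
move=> a b; have [v <-] := coker_pi_surj q.
by rewrite !coker_scaleE scalerDl raddfD.
Qed.
HB.instance Definition _ := GRing.Zmodule_isLmodule.Build A coker
  coker_scaleA coker_scale1 coker_scaleDr coker_scaleDl.

Lemma coker_pi_scalable : scalable coker_pi.
Proof. by move=> a v; rewrite -coker_scaleE. Qed.
HB.instance Definition _ :=
  GRing.isScalable.Build A V coker *:%R coker_pi coker_pi_scalable.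

End Cokernel.

(** * Group rings and semidirect products *)

(** Additive maps out of R[G] are given by additive maps on the coefficients at
    each group element. *)
Section AdditiveExtension.
Variables (R : pzRingType) (G : groupType) (V : zmodType) (f : G -> R -> V).
Hypothesis fD : forall g, {morph f g : a b / a + b}.

Definition gr_lift (a : group_ring R G) : V :=
  \sum_(g <- msupp a) f g (mcoeff g a).

Let f0 g : f g 0 = 0.
Proof. by apply: (addrI (f g 0)); rewrite -fD !addr0. Qed.

Lemma gr_liftw (d : {fset G}) a :
  msupp a `<=` d -> gr_lift a = \sum_(g <- d) f g (mcoeff g a).
Proof. by move=> le; apply/big_fset_incl => // g _ /mcoeff_outdom ->. Qed.

Lemma gr_liftD : {morph gr_lift : a b / a + b}.
Proof.
move=> a b; rewrite (gr_liftw (msuppD_le a b)).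
rewrite (gr_liftw (fsubsetUl (msupp a) (msupp b))).
rewrite (gr_liftw (fsubsetUr (msupp a) (msupp b))).
by rewrite -big_split /=; apply/eq_bigr=> g _; rewrite mcoeffD fD.
Qed.

Lemma gr_liftU (g : G) (a : R) : gr_lift (mkmalgU g a) = f g a.
Proof. by rewrite (gr_liftw msuppU_le) big_seq_fset1 mcoeffUU. Qed.

Lemma gr_lift0 : gr_lift 0 = 0.
Proof. by apply: (addrI (gr_lift 0)); rewrite -gr_liftD !addr0. Qed.

Lemma gr_lift_sum I (r : seq I) (F : I -> group_ring R G) :
  gr_lift (\sum_(i <- r) F i) = \sum_(i <- r) gr_lift (F i).
Proof. exact: (big_morph gr_lift gr_liftD gr_lift0). Qed.

Lemma gr_liftN a : gr_lift (- a) = - gr_lift a.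
Proof. by apply: (addrI (gr_lift a)); rewrite -gr_liftD !subrr gr_lift0. Qed.

End AdditiveExtension.

Section GroupElements.
Variables (R : pzRingType) (G : groupType).
Implicit Types (g h : G) (a b : R).

Definition gr_of (g : G) : group_ring R G := mkmalgU g 1.
Definition gr_cst (a : R) : group_ring R G := mkmalgU 1%g a.

Lemma gr_ofM g h : gr_of (g * h)%g = gr_of g * gr_of h.
Proof. by rewrite [RHS](gr_mulUU 1 1 g h) mulr1. Qed.

Lemma gr_of1 : gr_of 1%g = 1. Proof. by []. Qed.

Lemma gr_mulU_of g a h :
  (mkmalgU g a : group_ring R G) * gr_of h = mkmalgU (g * h)%g a.
Proof. by rewrite [LHS](gr_mulUU a 1 g h) mulr1. Qed.

Lemma gr_cst_of a g : gr_cst a * gr_of g = mkmalgU g a.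
Proof. by rewrite gr_mulU_of mul1g. Qed.

Lemma gr_cstD a b : gr_cst (a + b) = gr_cst a + gr_cst b.
Proof. exact: monalgUD. Qed.

Lemma gr_cstM a b : gr_cst (a * b) = gr_cst a * gr_cst b.
Proof. by rewrite [RHS](gr_mulUU a b 1%g 1%g) mulg1. Qed.

Lemma augmentationN (u : group_ring R G) : augmentation (- u) = - augmentation u.
Proof.
by apply: (addrI (augmentation u)); rewrite -augmentationD !subrr augmentation0.
Qed.

Lemma augmentation_of g : augmentation (gr_of g) = 1.
Proof. exact: augmentationU. Qed.

End GroupElements.
Arguments gr_of R {G} g.
Arguments gr_cst {R} G a.

Section Semidirect.
Variables (R : pzRingType) (G : groupType) (M : lmodType (group_ring R G)).

(** A homomorphism from G to this group over the identity of G is, in its first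
    component, a derivation from G to M. *)
Definition semidirect := (M * G)%type.
HB.instance Definition _ := Choice.on semidirect.

Definition sd_one : semidirect := (0, 1%g).
Definition sd_mul (u v : semidirect) : semidirect :=
  (u.1 + gr_of R u.2 *: v.1, (u.2 * v.2)%g).
Definition sd_inv (u : semidirect) : semidirect :=
  (- (gr_of R u.2^-1 *: u.1), u.2^-1%g).

Lemma sd_mulA : associative sd_mul.
Proof.
move=> [m g] [n h] [p k].
by rewrite /sd_mul /= scalerDr scalerA gr_ofM addrA mulgA.
Qed.
Lemma sd_mul1g : left_id sd_one sd_mul.
Proof. by move=> [m g]; rewrite /sd_mul /= gr_of1 scale1r add0r mul1g. Qed.
Lemma sd_mulg1 : right_id sd_one sd_mul.
Proof. by move=> [m g]; rewrite /sd_mul /= scaler0 addr0 mulg1. Qed.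
Lemma sd_mulVg : left_inverse sd_one sd_inv sd_mul.
Proof. by move=> [m g]; rewrite /sd_mul /= addNr mulVg. Qed.
Lemma sd_mulgV : right_inverse sd_one sd_inv sd_mul.
Proof.
move=> [m g]; rewrite /sd_mul /= scalerN scalerA -gr_ofM mulgV.
by rewrite gr_of1 scale1r subrr.
Qed.
HB.instance Definition _ := isGroup.Build semidirect
  sd_mulA sd_mul1g sd_mulg1 sd_mulVg sd_mulgV.

Lemma sd_snd_morph : {morph (fun u : semidirect => u.2) : u v / (u * v)%g}.
Proof. by []. Qed.

End Semidirect.

Section SemidirectMap.
Variables (R : pzRingType) (G : groupType) (M N : lmodType (group_ring R G)).
Variable f : {linear M -> N}.

Definition sd_map (u : semidirect M) : semidirect N := (f u.1, u.2).

Lemma sd_map_morph : {morph sd_map : u v / (u * v)%g}.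
Proof. by move=> [m g] [n h]; congr (_, _); rewrite /= linearD linearZ. Qed.
End SemidirectMap.

Section PrincipalDerivation.
Variables (R : pzRingType) (G : groupType).
Local Notation RG := (group_ring R G).

Definition sd_principal (g : G) : semidirect 'rV[RG]_1 :=
  (const_mx (gr_of R g - 1), g).

Lemma sd_principal_morph : {morph sd_principal : g h / (g * h)%g}.
Proof.
move=> g h; congr (_, _); apply/rowP => k; rewrite !mxE /= gr_ofM mulrBr mulr1.
by rewrite [RHS]addrC subrKA.
Qed.

Lemma sd_principal1 : (sd_principal 1%g).1 = 0.
Proof. by apply/rowP => k; rewrite /= gr_of1 !mxE subrr. Qed.

End PrincipalDerivation.

Section Criterion.
Variables (R : pzRingType) (G : groupType) (n m : nat).
Variable gen : 'I_n -> G.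
Local Notation RG := (group_ring R G).

Definition generates := forall P : G -> Prop,
  P 1%g -> (forall g h, P g -> P h -> P (g * h)%g) ->
  (forall g, P g -> P g^-1%g) ->
  (forall i, P (gen i)) -> forall g, P g.

(** The boundary from the free module on the generators to R[G], which sends the
    basis vector of a generator g to g - 1. *)
Definition gen_col : 'M[RG]_(n, 1) := \matrix_(i, j) (gr_of R (gen i) - 1).

Lemma sd_map_gen_col i :
  sd_map (mulmxr gen_col) (delta_mx 0 i, gen i) = sd_principal R (gen i).
Proof. by congr (_, _); rewrite /= -rowE; apply/rowP => k; rewrite !mxE. Qed.

Definition presentation_dim (i : nat) : nat :=
  match i with 0 => 1 | 1 => n | 2 => m | _ => 0 end.

Variable rels : 'M[RG]_(m, n).

Definition presentation_mx (i : nat) :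
    'M[RG]_(presentation_dim i.+1, presentation_dim i) :=
  match i with 0 => gen_col | 1 => rels | _ => 0 end.

Definition presentation_eps (v : 'rV[RG]_1) : trivial_module R G :=
  augmentation (v 0 0).

Lemma presentation_eps_linear : linear presentation_eps.
Proof.
by move=> a u v; rewrite /presentation_eps !mxE augmentationD augmentationM.
Qed.
HB.instance Definition _ :=
  GRing.isLinear.Build RG 'rV[RG]_1 (trivial_module R G)
    *:%R presentation_eps presentation_eps_linear.

(** The augmentation ideal is generated by the elements g - 1, and the g for
    which g - 1 lies in a given left ideal form a subgroup. *)
Lemma augmentation_kernel : generates ->
  forall a : RG, exists y : 'rV[RG]_n,
    (y *m gen_col) 0 0 = a - gr_cst G (augmentation a).
Proof.
move=> genG.
have mulI (a b : RG) : (exists y : 'rV[RG]_n, (y *m gen_col) 0 0 = b) ->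
    exists y : 'rV[RG]_n, (y *m gen_col) 0 0 = a * b.
  by case=> y <-; exists (a *: y); rewrite -scalemxAl mxE.
have addI (a b : RG) : (exists y : 'rV[RG]_n, (y *m gen_col) 0 0 = a) ->
    (exists y : 'rV[RG]_n, (y *m gen_col) 0 0 = b) ->
    exists y : 'rV[RG]_n, (y *m gen_col) 0 0 = a + b.
  by case=> y <- [z <-]; exists (y + z); rewrite mulmxDl mxE.
have I0 : exists y : 'rV[RG]_n, (y *m gen_col) 0 0 = 0.
  by exists 0; rewrite mul0mx mxE.
have group_case g : exists y : 'rV[RG]_n, (y *m gen_col) 0 0 = gr_of R g - 1.
  move: g; apply: genG => [|g h Ig Ih|g Ig|i].
  - by rewrite gr_of1 subrr.
  - have -> : gr_of R (g * h)%g - 1 =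
        gr_of R g * (gr_of R h - 1) + (gr_of R g - 1).
      by rewrite gr_ofM mulrBr mulr1 addrA subrK.
    by apply: addI => //; apply: mulI.
  - have -> : gr_of R g^-1%g - 1 = - gr_of R g^-1%g * (gr_of R g - 1).
      by rewrite mulNr mulrBr mulr1 -gr_ofM mulVg gr_of1 opprB.
    exact: mulI.
  - by exists (delta_mx 0 i); rewrite -rowE !mxE.
apply: gr_ind => [|a b Ia Ib|g x].
- by rewrite augmentation0 /gr_cst monalgU0 subrr.
- by rewrite augmentationD gr_cstD opprD addrACA; apply: addI.
- by rewrite augmentationU -gr_cst_of -[X in _ - X]mulr1 -mulrBr; apply: mulI.
Qed.

(** M plays the role of the free module on the generators modulo the relation
    rows, and D that of the derivation sending each generator to its basis
    vector.  Extended R-linearly to R[G], D sends a (g - 1) to a D(g); so it maps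
    the boundary of v to the class of v in M, and a cycle v has class 0. *)
Lemma type_FP2_criterion (M : lmodType RG) (p : {linear 'rV[RG]_n -> M})
    (D : G -> M) :
  generates -> rels *m gen_col = 0 ->
  (forall v, p v = 0 -> exists y, v = y *m rels) ->
  (forall g h, D (g * h)%g = D g + gr_of R g *: D h) ->
  (forall i, D (gen i) = p (delta_mx 0 i)) ->
  type_FP 2 R G.
Proof.
move=> genG rels0 pker DM Dgen.
exists (fun i => 'rV[RG]_(presentation_dim i) : lmodType RG).
exists (fun i => mulmxr (presentation_mx i)), presentation_eps.
split=> [i _|x|_ v|[|//] _ v].
- split; [exact: free_projective|exact: free_finitely_generated].
- exists (const_mx (gr_cst G x)); rewrite /= /presentation_eps mxE.
  exact: augmentationU.
- rewrite /= /presentation_eps; split=> [v0|[y <-]].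
    have [y yE] := augmentation_kernel genG (v 0 0).
    exists y; apply/rowP => j; rewrite !ord1.
    by rewrite [LHS]yE v0 /gr_cst monalgU0 subr0.
  rewrite mxE (big_morph _ (@augmentationD R G) (@augmentation0 R G)).
  rewrite big1 // => i _; rewrite mxE augmentationM augmentationD.
  by rewrite augmentation_of augmentationN augmentation1 subrr mulr0.
- rewrite /=; split=> [v0|[y <-]]; last by rewrite -mulmxA rels0 mulmx0.
  have [|y ->] := pker v; last by exists y.
  pose f g (x : R) : M := gr_cst G x *: D g.
  have fD g : {morph f g : a b / a + b}.
    by move=> a b; rewrite /f gr_cstD scalerDl.
  have liftM a h : gr_lift f (a * (gr_of R h - 1)) = a *: D h.
    elim/gr_ind: a => [|a b Ia Ib|g x].
    + by rewrite mul0r gr_lift0 // scale0r.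
    + by rewrite mulrDl gr_liftD // Ia Ib scalerDl.
    + rewrite mulrBr mulr1 gr_mulU_of gr_liftD // gr_liftN // !gr_liftU //.
      by rewrite /f DM scalerDr scalerA gr_cst_of addrC addKr.
  rewrite lincomb_linear /lincomb.
  under eq_bigr => i _ do rewrite -Dgen -liftM.
  rewrite -gr_lift_sum // -[RHS](gr_lift0 fD); congr gr_lift.
  transitivity ((v *m gen_col) 0 0); last by rewrite v0 mxE.
  by rewrite mxE; apply: eq_bigr => i _; rewrite mxE.
Qed.

End Criterion.

(** * Type FP2 over a field *)

Section Naturality.
Local Open Scope group_scope.
Variables (L K : groupType) (f : L -> K).
Hypothesis fM : {morph f : u v / u * v}.
Variables x y z s t : L.

Let fV := morphgV fM.
Let fR : {morph f : u v / [~ u, v]}.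
Proof. by move=> u v; rewrite /commg /conjg !fM !fV. Qed.

Lemma relators_morph :
  relators (f x) (f y) (f z) (f s) (f t) = map f (relators x y z s t).
Proof.
by rewrite /relators /commg /conjg /= !expg2 !(fM, fV).
Qed.

Lemma X24_morph a : f (X24 y z s a) = X24 (f y) (f z) (f s) a.
Proof. by rewrite /X24 (morph_dpow fM) fR fV. Qed.

Lemma central_word_morph a :
  f (central_word x y z s a) = central_word (f x) (f y) (f z) (f s) a.
Proof. by rewrite /central_word fR X24_morph. Qed.

Lemma abels_word_morph g :
  f (abels_word x y z s t g) = abels_word (f x) (f y) (f z) (f s) (f t) g.
Proof.
rewrite /abels_word fM 4!fM fM X24_morph /X12 /X13 /X34 /X23.
by rewrite !(morph_dpow fM) !(morph_zexp fM) !fV fR.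
Qed.

End Naturality.

Definition abels_gen (i : 'I_5) : abels := nth 1%g [:: gx; gy; gz; gs; gt] i.

(** Each element is its own abels_word in the generators. *)
Lemma abels_generated : generates abels_gen.
Proof.
move=> P P1 PM PV Pgen g.
have Px : P gx := Pgen 0.
have Py : P gy := Pgen 1.
have Pz : P gz := Pgen 2%:R.
have Ps : P gs := Pgen 3%:R.
have Pt : P gt := Pgen 4%:R.
have PX (h : abels) (n : nat) : P h -> P (h ^+ n)%g.
  by move=> Ph; elim: n => [|n IHn] //; rewrite expgS; apply: (PM).
have PZ h k : P h -> P (zexp h k).
  by move=> Ph; case: k => n /=; [|apply: (PV)]; apply: (PX).
have PJ h k : P h -> P k -> P (h ^ k)%g.
  by move=> Ph Pk; apply: (PM); [apply: (PV)|apply: (PM)].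
have PR h k : P h -> P k -> P [~ h, k]%g.
  by move=> Ph Pk; apply: (PM); [apply: (PV)|apply: (PJ)].
have PD h k a : P h -> P k -> P (dpow k h a).
  move=> Ph Pk; rewrite /dpow unlock; apply: (PJ); first exact: PZ.
  by apply: (PV); apply: (PX).
rewrite -(abels_wordK g) /abels_word; apply: (PM); last by apply: (PM); apply: (PZ).
by do 4?[apply: (PM)]; apply: (PD) => //; first [exact: (PR) | exact: (PV)].
Qed.

Lemma abels_relatorsE : relators gx gy gz gs gt = nseq 14 1%g.
Proof. by apply/all_pred1P/allP => r r_rel; apply/eqP/abels_relators. Qed.

(** If 2 is invertible in F, then theta (k / 2^n) is k / 2^n times theta 1.  If
    2 = 0 in F, then theta a is twice theta (a / 2), hence 0. *)
Lemma dyadic_additive_eq0 (F : fieldType) (G : groupType)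
    (V : lmodType (group_ring F G)) (theta : dyadic_rat -> V) :
  {morph theta : a b / a + b} -> theta 1 = 0 -> forall a, theta a = 0.
Proof.
move=> thetaD theta1 a.
have theta0 : theta 0 = 0 by apply: (addrI (theta 0)); rewrite -thetaD !addr0.
have thetaN b : theta (- b) = - theta b.
  by apply: (addrI (theta b)); rewrite -thetaD !subrr theta0.
have thetaZ (k : int) : theta k%:~R = 0.
  elim/int_rect: k => [|n IHn|n IHn] //.
    by rewrite -addn1 PoszD intrD thetaD IHn theta1 addr0.
  by rewrite -addn1 PoszD opprD intrD thetaD IHn intrN thetaN theta1 oppr0 addr0.
have gr_cst2 v : gr_cst G 2 *: v = v + v :> V.
  by rewrite [2]mulr2n gr_cstD scalerDl [gr_cst G 1](gr_of1 F G) scale1r.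
have theta2 b : gr_cst G 2 *: theta (pow2 (-1) * b) = theta b.
  by rewrite gr_cst2 -thetaD; congr theta; ring: pow2N1.
have [two0|two_neq0] := eqVneq (2 : F) 0.
  by rewrite -theta2 two0 /gr_cst monalgU0 scale0r.
have half n (b : dyadic_rat) : theta b = 0 -> theta (pow2 (- n%:Z) * b) = 0.
  elim: n b => [|n IHn] b b0; first by rewrite oppr0 pow2_0 mul1r.
  rewrite -[LHS]scale1r -[1](gr_of1 F G) /gr_of -(mulVf two_neq0).
  rewrite -/(gr_cst G _) gr_cstM -scalerA intS opprD pow2D -mulrA theta2 IHn //.
  by rewrite scaler0.
by have [[k n] ->] := dyadicE a; rewrite mulrC; apply: half.
Qed.

Section FieldCase.
Variable F : fieldType.
Local Notation FG := (group_ring F abels).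
Local Notation M0 := 'rV[FG]_5.

Definition lift_gen (i : 'I_5) : semidirect M0 := (delta_mx 0 i, abels_gen i).

Definition lift_relators : seq (semidirect M0) :=
  relators (lift_gen 0) (lift_gen 1) (lift_gen 2%:R) (lift_gen 3%:R)
    (lift_gen 4%:R).

(** The rows are the Fox derivatives of the relators: evaluating a word in the
    pairs (basis vector, generator) of the semidirect product computes its Fox
    derivative in the first component. *)
Definition fox_mx : 'M[FG]_(14, 5) :=
  \matrix_(j, k) (nth 1%g lift_relators j).1 0 k.

Lemma relators_gen_snd : map snd lift_relators = nseq 14 1%g.
Proof.
by rewrite -(relators_morph (@sd_snd_morph F abels M0)) -abels_relatorsE.
Qed.

Lemma lift_relatorE (j : 'I_14) : nth 1%g lift_relators j = (row j fox_mx, 1%g).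
Proof.
have -> : row j fox_mx = (nth 1%g lift_relators j).1.
  by apply/rowP => k; rewrite !mxE.
have : nth 1%g (map snd lift_relators) j = 1%g.
  by rewrite relators_gen_snd nth_nseq ltn_ord.
rewrite (nth_map (1%g : semidirect M0)) //.
by case: (nth _ _ _) => a b /= ->.
Qed.

(** The boundary map takes the pairs (basis vector, generator) to the values of
    a homomorphism defined on G, which kills the relators. *)
Lemma fox_mx_gen_col : fox_mx *m gen_col F abels_gen = 0.
Proof.
pose eta := @sd_principal F abels.
have etaM : {morph eta : g h / (g * h)%g} := @sd_principal_morph F abels.
pose f := @sd_map F abels M0 _ (mulmxr (gen_col F abels_gen)).
have fgen i : f (lift_gen i) = eta (abels_gen i).
  exact: (sd_map_gen_col F abels_gen i).
have fM : {morph f : u v / (u * v)%g} := sd_map_morph _.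
apply/row_matrixP => j; rewrite row_mul row0.
have E : map f lift_relators = map eta (relators gx gy gz gs gt).
  by rewrite -(relators_morph fM) -(relators_morph etaM) !fgen.
have : nth 1%g (map f lift_relators) j = eta 1%g.
  by rewrite E abels_relatorsE map_nseq nth_nseq ltn_ord.
have j_lt : (j < size lift_relators)%N := ltn_ord j.
rewrite (nth_map (1%g : semidirect M0) _ _ j_lt).
rewrite lift_relatorE => /(congr1 fst) E1; apply: etrans E1 _.
exact: sd_principal1.
Qed.

(** The generators paired with their basis vectors satisfy the relators modulo
    the Fox derivatives, so G lifts as soon as the corner commutators vanish;
    these have trivial image in G, so they form an additive map from Z[1/2] to
    the module of classes, which vanishes at 1 by the last relator. *)
Lemma abels_FP2 : type_FP 2 F abels.
Proof.
pose rel_map : {linear 'rV[FG]_14 -> M0} := mulmxr fox_mx.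
pose M : lmodType FG := coker rel_map.
pose p : {linear M0 -> M} := coker_pi rel_map.
pose f := sd_map p.
have fM : {morph f : u v / (u * v)%g} := sd_map_morph _.
pose fl i := f (lift_gen i).
have rel r :
    r \in relators (fl 0) (fl 1) (fl 2%:R) (fl 3%:R) (fl 4%:R) -> r = 1%g.
  rewrite (relators_morph fM) => /mapP[u u_rel ->].
  have /(nthP 1%g)[j j_lt <-] := u_rel.
  have := lift_relatorE (Ordinal (j_lt : (j < 14)%N)) => /= ->.
  congr (_, _); rewrite /=; apply/coker_pi_eq0.
  by exists (delta_mx 0 (Ordinal (j_lt : (j < 14)%N))); rewrite /= -rowE.
pose word := abels_word (fl 0) (fl 1) (fl 2%:R) (fl 3%:R) (fl 4%:R).
have snd_word g : (word g).2 = g.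
  rewrite /word (abels_word_morph (@sd_snd_morph F abels M)).
  exact: abels_wordK.
pose central := central_word (fl 0) (fl 1) (fl 2%:R) (fl 3%:R).
have snd_central a : (central a).2 = 1%g.
  rewrite /central (central_word_morph (@sd_snd_morph F abels M)).
  exact: central_word_abels.
have centralD a b : (central (a + b)).1 = (central a).1 + (central b).1.
  have -> : central (a + b) = (central a * central b)%g := central_wordD rel a b.
  rewrite -[LHS]/((central a).1 + gr_of F (central a).2 *: (central b).1).
  by rewrite snd_central gr_of1 scale1r.
have central_1 : (central 1).1 = 0.
  by rewrite /central (central_word1 rel).
have central1 a : central a = 1%g.
  rewrite [LHS]surjective_pairing snd_central; congr (_, _).
  exact: dyadic_additive_eq0 centralD central_1 a.
have wordM : {morph word : g h / (g * h)%g} := abels_wordM rel central1.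
apply: (type_FP2_criterion (rels := fox_mx) (p := p)
  (D := fun g => (word g).1)).
- exact: abels_generated.
- exact: fox_mx_gen_col.
- by move=> v /coker_pi_eq0[w <-]; exists w.
- move=> g h; rewrite wordM.
  by rewrite -[LHS]/((word g).1 + gr_of F (word g).2 *: (word h).1) snd_word.
- move=> i; have -> : p (delta_mx 0 i) = (fl i).1 by [].
  congr (_.1); move: i; case=> [[|[|[|[|[|//]]]]] lt_i].
  all: rewrite /word /abels_gen /=.
  + rewrite (abels_word_x rel); congr fl; exact: val_inj.
  + rewrite (abels_word_y rel); congr fl; exact: val_inj.
  + rewrite (abels_word_z rel); congr fl; exact: val_inj.
  + rewrite (abels_word_s rel); congr fl; exact: val_inj.
  + rewrite (abels_word_t rel); congr fl; exact: val_inj.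
Qed.

End FieldCase.

(** * Cocycles and type FP2 over the integers *)

Section CocycleExtension.
Variables (G : groupType) (V : zmodType) (c : G -> G -> V).
Local Notation ZG := (group_ring int G).
Hypothesis cocycle : forall g h k,
  c g h + c (g * h)%g k = c h k + c g (h * k)%g.

Let rowf (g h : G) (m : int) : V := c g h *~ m.
Let rowfD g h : {morph rowf g h : m n / m + n}.
Proof. by move=> m n; rewrite /rowf mulrzDr. Qed.
Let colf (x : ZG) (g : G) (m : int) : V := gr_lift (rowf g) x *~ m.
Let colfD x g : {morph colf x g : m n / m + n}.
Proof. by move=> m n; rewrite /colf mulrzDr. Qed.

Definition cocycle_ext (y x : ZG) : V := gr_lift (colf x) y.

Lemma cocycle_extDl x : {morph cocycle_ext^~ x : y z / y + z}.
Proof. exact: gr_liftD. Qed.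

Lemma cocycle_extDr y : {morph cocycle_ext y : x z / x + z}.
Proof.
move=> x z; rewrite /cocycle_ext /gr_lift -big_split /=; apply: eq_bigr => g _.
by rewrite /colf gr_liftD // mulrzDl.
Qed.

Lemma cocycle_ext0l x : cocycle_ext 0 x = 0.
Proof. exact: gr_lift0. Qed.

Lemma cocycle_ext0r y : cocycle_ext y 0 = 0.
Proof. by apply: (addrI (cocycle_ext y 0)); rewrite -cocycle_extDr !addr0. Qed.

Lemma cocycle_extNr y x : cocycle_ext y (- x) = - cocycle_ext y x.
Proof.
by apply: (addrI (cocycle_ext y x)); rewrite -cocycle_extDr !subrr cocycle_ext0r.
Qed.

Lemma cocycle_extUU g h m n :
  cocycle_ext (mkmalgU g m) (mkmalgU h n) = c g h *~ (n * m).
Proof. by rewrite /cocycle_ext gr_liftU // /colf gr_liftU // /rowf mulrzA. Qed.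

Lemma cocycle_ext_of g h : cocycle_ext (gr_of int g) (gr_of int h) = c g h.
Proof. by rewrite cocycle_extUU. Qed.

Lemma cocycle_extM y z x :
  cocycle_ext y z *~ augmentation x + cocycle_ext (y * z) x =
  cocycle_ext z x *~ augmentation y + cocycle_ext y (z * x).
Proof.
elim/gr_ind: y z x => [|y y' Hy Hy'|g m] z x.
- by rewrite mul0r !cocycle_ext0l augmentation0 mulr0z mul0rz !addr0.
- rewrite mulrDl !cocycle_extDl mulrzDl addrACA Hy Hy' augmentationD mulrzDr.
  by rewrite addrACA.
elim/gr_ind: z x => [|z z' Hz Hz'|h n] x.
- by rewrite mulr0 mul0r cocycle_ext0r !cocycle_ext0l !mul0rz addr0.
- rewrite mulrDr mulrDl !(cocycle_extDl, cocycle_extDr) !mulrzDl addrACA Hz Hz'.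
  by rewrite addrACA.
elim/gr_ind: x => [|x x' Hx Hx'|k p].
- by rewrite mulr0 !cocycle_ext0r augmentation0 mulr0z mul0rz.
- rewrite mulrDr !cocycle_extDr augmentationD mulrzDr mulrzDl addrACA Hx Hx'.
  by rewrite addrACA.
have mulUU (g' h' : G) (m' n' : int) :
    (mkmalgU g' m' : ZG) * mkmalgU h' n' = mkmalgU (g' * h')%g (m' * n').
  exact: gr_mulUU.
rewrite !mulUU.
rewrite !cocycle_extUU !augmentationU -!mulrzA.
have -> : n * m * p = p * (m * n) by ring.
have -> : p * n * m = p * (m * n) by ring.
have -> : n * p * m = p * (m * n) by ring.
by rewrite -!mulrzDl cocycle.
Qed.

End CocycleExtension.

Section FP2Cocycle.
Variables (G : groupType) (V : zmodType) (c : G -> G -> V).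
Local Notation ZG := (group_ring int G).
Hypothesis cocycle : forall g h k,
  c g h + c (g * h)%g k = c h k + c g (h * k)%g.

Let C := cocycle_ext c.

(** In dimension 0, f0 compares the resolution with Z[G].  In dimension 1, kappa
    is the part with values in V of a comparison map from P 1 to the extension
    of the augmentation ideal by V that c defines; kappa is additive, and
    cocycle_ext measures its failure to be equivariant.  On the image of P 2 it
    is equivariant, so its values there form a group generated by finitely many
    elements b i.  Conversely, sigma starts a comparison of the bar resolution
    with P, and sigma g + g sigma h - sigma (g h) is a cycle, hence in the image
    of P 2; applying kappa to it gives the formula. *)
Lemma FP2_cocycle_finite : type_FP 2 int G ->
  exists (n : nat) (b : 'I_n -> V) (beta : G -> V), forall g h,
    exists k : 'I_n -> int,
      c g h + beta g + beta h - beta (g * h)%g = \sum_i b i *~ k i.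
Proof.
case=> P [d [eps [Pfp eps_surj /(_ isT) ex0 /(_ 0%N isT) ex1]]].
have [proj0 [n0 [v0 gen0]]] := Pfp 0%N isT.
have [proj1 [n1 [v1 gen1]]] := Pfp 1%N isT.
have [_ [n2 [v2 gen2]]] := Pfp 2%N isT.
have [phi0 phi0K] := projective_dual_basis proj0 gen0.
have [phi1 phi1K] := projective_dual_basis proj1 gen1.
pose f0 x : ZG := \sum_i phi0 x 0 i * gr_cst G (eps (v0 i)).
have f0D x y : f0 (x + y) = f0 x + f0 y.
  rewrite /f0 -big_split; apply: eq_bigr => i _.
  by rewrite linearD mxE mulrDl.
have f0Z a x : f0 (a *: x) = a * f0 x.
  rewrite /f0 mulr_sumr; apply: eq_bigr => i _.
  by rewrite linearZ mxE mulrA.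
have aug_f0 x : augmentation (f0 x) = eps x.
  rewrite -[in RHS](phi0K x) linear_sum.
  rewrite /f0 (big_morph _ (@augmentationD int G) (@augmentation0 int G)).
  by apply: eq_bigr => i _; rewrite augmentationM augmentationU linearZ.
have f0_0 : f0 0 = 0 by apply: (addrI (f0 0)); rewrite -f0D !addr0.
have f0_sum I (r : seq I) (F : I -> P 0%N) :
    f0 (\sum_(i <- r) F i) = \sum_(i <- r) f0 (F i).
  exact: (big_morph f0 f0D f0_0).
pose xi i := f0 (d 0%N (v1 i)).
have eps_d x : eps (d 0%N x) = 0 by apply/ex0; exists x.
pose kappa x := \sum_i C (phi1 x 0 i) (xi i).
have kappaD x y : kappa (x + y) = kappa x + kappa y.
  rewrite /kappa -big_split; apply: eq_bigr => i _.
  by rewrite linearD mxE /C cocycle_extDl.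
have kappa0 : kappa 0 = 0 by apply: (addrI (kappa 0)); rewrite -kappaD !addr0.
have kappaN x : kappa (- x) = - kappa x.
  by apply: (addrI (kappa x)); rewrite -kappaD !subrr.
have kappaZ a x : kappa (a *: x) = kappa x *~ augmentation a + C a (f0 (d 0%N x)).
  rewrite -[in f0 _](phi1K x) linear_sum f0_sum.
  rewrite /C (big_morph _ (cocycle_extDr c a) (cocycle_ext0r c a)).
  rewrite /kappa mulrz_suml -big_split; apply: eq_bigr => i _.
  rewrite linearZ mxE linearZ f0Z -/(xi i).
  have := cocycle_extM cocycle a (phi1 x 0 i) (xi i).
  by rewrite aug_f0 eps_d mulr0z add0r.
have dd z : d 0%N (d 1%N z) = 0 by apply/ex1; exists z.
have [e0 e0E] := eps_surj 1.
have sigma_ex g : exists s, d 0%N s = gr_of int g *: e0 - e0.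
  apply/ex0; rewrite linearB linearZZ e0E.
  rewrite -[_ *: _]/(augmentation (gr_of int g) * 1) augmentation_of.
  exact: subrr.
have [sigma sigmaE] := choice sigma_ex.
pose theta := f0 e0.
have aug_theta : augmentation theta = 1 by rewrite /theta aug_f0.
exists n2, (fun i => kappa (d 1%N (v2 i))).
exists (fun g => kappa (sigma g) - C (gr_of int g) theta) => g h.
have [z zE] : exists z, d 1%N z =
    sigma g + gr_of int g *: sigma h - sigma (g * h)%g.
  apply/ex1; rewrite linearB linearD linearZZ !sigmaE scalerBr scalerA -gr_ofM.
  by rewrite [X in X - _]addrC subrKA subrr.
have [a zsum] := gen2 z.
exists (fun i => augmentation (a i)).
transitivity (kappa (d 1%N z)); last first.
  rewrite zsum linear_sum (big_morph kappa kappaD kappa0).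
  apply: eq_bigr => i _; rewrite linearZ kappaZ dd.
  by rewrite f0_0 /C cocycle_ext0r addr0.
rewrite zE !kappaD kappaN kappaZ augmentation_of mulr1z sigmaE.
rewrite f0D -scaleN1r !f0Z mulN1r -/theta /C cocycle_extDr cocycle_extNr.
have := cocycle_extM cocycle (gr_of int g) (gr_of int h) theta.
rewrite aug_theta augmentation_of !mulr1z cocycle_ext_of -gr_ofM.
move=> E; have -> : cocycle_ext c (gr_of int g) (gr_of int h * theta) =
    c g h + cocycle_ext c (gr_of int (g * h)%g) theta
    - cocycle_ext c (gr_of int h) theta.
  by rewrite E addrAC subrr add0r.
by rewrite !opprB !addrA [LHS](ACl (2*4*1*6*5*3*7)).
Qed.

End FP2Cocycle.

(** * The group is not of type FP2 over the integers *)

(** A finitely generated group of rationals has a common denominator. *)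
Lemma dyadic_not_spanned (n : nat) (b : 'I_n -> rat) :
  ~ (forall a : dyadic_rat, exists k : 'I_n -> int, val a = \sum_i b i *~ k i).
Proof.
move=> span; pose D := \prod_i denq (b i).
have D_gt0 : 0 < D by apply: prodr_gt0 => i _; apply: denq_gt0.
have DP (a : dyadic_rat) : exists m : int, D%:~R * val a = m%:~R :> rat.
  have [k ->] := span a.
  pose num i := (\prod_(j < n | j != i) denq (b j)) * numq (b i).
  exists (\sum_i num i * k i).
  rewrite mulr_sumr rmorph_sum; apply: eq_bigr => i _ /=.
  rewrite intrM -[b i *~ k i]mulrzr mulrA; congr (_ * _).
  by rewrite /D (bigD1 i) //= mulrC !intrM mulrA -numqE mulrC.
(* any exponent n with D < 2^n would do; n = D is one *)
have [m] := DP (pow2 (- `|D|%N%:Z)).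
rewrite /= -exprnN => Em.
have two_neq0 : (2 : rat) ^+ `|D| != 0 by rewrite expf_eq0 andbF.
have {}Em : D = m * 2 ^+ `|D|%N.
  apply: (@intr_inj rat); rewrite intrM rmorphXn /= -Em.
  by rewrite divfK.
have m_gt0 : 0 < m.
  by rewrite -(pmulr_lgt0 _ (exprn_gt0 `|D|%N (ltr0n int 2))) -Em.
have : (2 ^+ `|D|%N <= D)%R.
  by rewrite [leRHS]Em ler_peMl ?exprn_ge0 // -gtz0_ge1.
have <- : (2 ^ `|D|)%N%:Z = 2 ^+ `|D| by rewrite -natz natrX.
apply/negP; rewrite -ltNge -{1}(gtz0_abs D_gt0) ltz_nat.
exact: ltn_expl.
Qed.

(** The difference c(g,h) - c(h,g) of a cocycle at commuting elements is unchanged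
    by coboundaries; at the classes of I + E12 and I + a E24 it is a. *)
Lemma abels_not_FP2_int : ~ type_FP 2 int abels.
Proof.
move=> /(FP2_cocycle_finite corner_cocycleP)[n [b [beta span]]].
apply: (@dyadic_not_spanned n b) => a.
pose g := Abels 1 0 0 0 0 0 0; pose h := Abels 0 0 a 0 0 0 0.
have [k kE] := span g h; have [l lE] := span h g.
have gh : (g * h = h * g)%g by rewrite /g /h; abels_eq.
exists (fun i => k i - l i).
transitivity (corner_cocycle g h - corner_cocycle h g).
  have -> : corner_cocycle h g = 0.
    rewrite /corner_cocycle -(rmorph0 (val : dyadic_rat -> rat)).
    by congr val => /=; ring.
  by rewrite corner_cocycle_pairing (rmorph1 (val : dyadic_rat -> rat)) mul1r subr0.
under eq_bigr => i _ do rewrite mulrzBr.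
rewrite sumrB -kE -lE gh.
ring.
Qed.

Theorem theorem1p3 :
  exists G : groupType,
    (forall F : fieldType, type_FP 2 F G) /\ ~ type_FP 2 int G.
Proof. exists abels; split; [exact: abels_FP2|exact: abels_not_FP2_int]. Qed.
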